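(* Let $f:\mathcal C\to\mathbb R^n$ be Lipschitz on bounded sets with $f(0)=0$, and let $\mathcal D:\mathcal C\to\mathbb R^n$, $\mathcal D\phi=\phi(0)-\sum_{j=1}^pA_j\phi(-\Delta_j)$, be strongly stable. The system described by $$\frac{d}{dt}\mathcal Dx_t=f(x_t),\quad t\ge 0,\qquad x(\tau)=\xi_0(\tau),\ \tau\in[-\Delta,0],\ \xi_0\in\mathcal C,$$ is $0$-GES if and only if there exist a locally Lipschitz functional $V:\mathcal C\to\mathbb R^+$ and positive reals $a_1,a_2,a_3$ such that the following conditions hold for all $\phi\in\mathcal C$: (i) $a_1|\mathcal D\phi|\le V(\phi)\le a_2\|\phi\|$; (ii) $D^+V(\phi)\le-a_3V(\phi)$.
   Context: Notation. $\mathbb R^+=[0,+\infty)$; $|\cdot|$ is the Euclidean norm on $\mathbb R^n$; $n,p$ are positive integers; $\Delta>0$ is real; $0<\Delta_j\le\Delta$ are reals and $A_j\in\mathbb R^{n\times n}$, $j=1,\dots,p$. $\mathcal C$ is the Banach space of continuous functions $[-\Delta,0]\to\mathbb R^n$ with the supremum norm $\|\cdot\|$; $\mathcal C_H=\{\psi\in\mathcal C:\|\psi\|\le H\}$. For a function $x$ on $[-\Delta,c)$ and $t\in[0,c)$, $x_t\in\mathcal C$ is $x_t(\tau)=x(t+\tau)$, $\tau\in[-\Delta,0]$. A solution on $[0,b)$ is a continuous $x:[-\Delta,b)\to\mathbb R^n$ with $x_0=\xi_0$ such that $t\mapsto\mathcal Dx_t$ is continuously differentiable and satisfies the equation (one-sided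 derivative at $t=0$). Strong stability. $\mathcal D$ is strongly stable (Hale and Lunel) if for every choice of positive delays $r_1,\dots,r_p$ the zero solution of the difference equation $y(t)=\sum_{j=1}^pA_jy(t-r_j)$ is uniformly asymptotically stable; equivalently, $\sup\{\rho(\sum_{j=1}^pA_je^{i\theta_j}):\theta_j\in[0,2\pi]\}<1$, where $\rho$ is the spectral radius. Lipschitz notions. A map $Q$ on $\mathcal C$ is locally Lipschitz if for every $\phi\in\mathcal C$ there are $H,L>0$ with $|Q(\phi_1)-Q(\phi_2)|\le L\|\phi_1-\phi_2\|$ whenever $\|\phi_i-\phi\|\le H$, $i=1,2$; it is Lipschitz on bounded sets if for every $H>0$ there is $L>0$ such that this inequality holds for all $\phi_1,\phi_2\in\mathcal C_H$. 0-GES. The system is $0$-GES if there exist positive reals $M,\lambda$ such that, for any $\xi_0\in\mathcal C$, the corresponding solution exists for all $t\in\mathbb R^+$ and satisfies $|x(t)|\le Me^{-\lambda t}\|\xi_0\|$ for all $t\ge0$. Derivative. For locally Lipschitz $V:\mathcal C\to\mathbb R^+$, $D^+V:\mathcal C\to[-\infty,+\infty]$ is $$D^+V(\phi)=\limsup_{h\to0^+}\frac{V(\phi_h)-V(\phi)}{h},$$ where, for $0<h<\Delta$, $\phi_h\in\mathcal C$ is given by $\phi_h(s)=\phi(s+h)$ for $s\in[-\Delta,-h]$ and $\phi_h(s)=\mathcal D\phi+f(\phi)(s+h)-\mathcal D\phi^\star_{s+h}+\phi(0)$ for $s\in(-h,0]$; and, for $0<\theta\le h$, $\phi^\star_\theta\in\mathcal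 C$ is given by $\phi^\star_\theta(s)=\phi(s+\theta)$ for $s\in[-\Delta,-\theta]$ and $\phi^\star_\theta(s)=\phi(0)$ for $s\in(-\theta,0]$. *)

(* Defs.v *)
(* MathComp-Analysis, over an arbitrary [R : realType]. *)
From HB Require Import structures.
From mathcomp Require Import all_boot all_order all_algebra.
From mathcomp Require Import all_classical all_reals all_analysis.

Set Implicit Arguments.
Unset Strict Implicit.
Unset Printing Implicit Defensive.

Import Order.TTheory GRing.Theory Num.Theory.
Import numFieldNormedType.Exports.

Local Open Scope classical_set_scope.
Local Open Scope ring_scope.

(* The library norm on matrices is the max norm. *)
Definition enorm (R : realType) (n : nat) (v : 'cV[R]_n) : R :=
  Num.sqrt (\sum_i v i 0 ^+ 2).

Section PhaseSpace.
Context {R : realType} (Delta : R) (n : nat).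

(* The retraction of the line onto [-Delta, 0]. *)
Definition clamp (s : R) : R := Num.max (- Delta) (Num.min s 0).

(* A continuous function [-Delta, 0] -> R^n is represented by its unique
   extension to R that is constant to the left of -Delta and to the right of 0;
   Leibniz equality is then equality of functions on [-Delta, 0]. *)
Definition contC : {pred R -> 'cV[R]_n} :=
  [pred g | `[< continuous g /\ forall s, g s = g (clamp s) >]].

Lemma contC_submod_closed : submod_closed contC.
Proof.
split=> [|a g h /asboolP[gc ge] /asboolP[hc he]]; apply/asboolP; split => //.
- by move=> s; exact: cst_continuous.
- move=> s; apply: (@continuousD _ _ _ (fun s => a *: g s)); last exact: hc.
  by apply: continuousZl_tmp; exact: gc.
- by move=> s; rewrite !fctE ge he.
Qed.

HB.instance Definition _ :=
  GRing.isSubmodClosed.Build R (R -> 'cV[R]_n) contC contC_submod_closed.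

Record C := MkC { Cfun :> R -> 'cV[R]_n; CfunP : Cfun \in contC }.

HB.instance Definition _ := [isSub for Cfun].
HB.instance Definition _ := [Choice of C by <:].
HB.instance Definition _ := [SubChoice_isSubLmodule of C by <:].

Definition cnorm (phi : C) : R :=
  sup [set enorm (phi s) | s in `[- Delta, 0]].

(* The element of C that agrees with g on [-Delta, 0]; it is the zero function
   when g is not continuous there (see [restrCE]). *)
Definition restrC (g : R -> 'cV[R]_n) : C := insubd (0 : C) (g \o clamp).

Definition segment (x : R -> 'cV[R]_n) (t : R) : C :=
  restrC (fun tau => x (t + tau)).

Lemma clamp_id s : s \in `[- Delta, 0] -> clamp s = s.
Proof.
by rewrite in_itv/= /clamp => /andP[h1 h2]; rewrite (min_idPl h2) (max_idPr h1).
Qed.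

Lemma clamp_continuous : continuous clamp.
Proof.
move=> s; apply: (@continuous_max R R (cst (- Delta)) (fun s => Num.min s 0)).
  exact: cst_continuous.
by apply: (@continuous_min R R id (cst 0)) => //; exact: cst_continuous.
Qed.

Lemma clamp_itv s : 0 <= Delta -> clamp s \in `[- Delta, 0].
Proof.
move=> D0; rewrite in_itv/= /clamp le_max lexx/= ge_max oppr_le0 D0/=.
by rewrite ge_min lexx orbT.
Qed.

Lemma restrC_subproof (g : R -> 'cV[R]_n) : 0 <= Delta ->
  {within `[- Delta, 0], continuous g} -> g \o clamp \in contC.
Proof.
move=> D0 gc; apply/asboolP; split; last first.
  by move=> s; rewrite /= (clamp_id (clamp_itv s D0)).
move=> s; have /subspace_continuousP/(_ (clamp s)) := gc.
move=> /(_ (clamp_itv s D0)) h.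
apply: cvg_comp h => A /=; rewrite /within/= => nA.
have := @clamp_continuous s _ nA; rewrite /nbhs/=.
by apply: (@filterS _ (nbhs s)) => u /=; apply; exact: clamp_itv.
Qed.

Lemma restrCE (g : R -> 'cV[R]_n) : 0 <= Delta ->
  {within `[- Delta, 0], continuous g} ->
  {in `[- Delta, 0], restrC g =1 g}.
Proof.
move=> D0 gc s sD; rewrite /restrC.
have := @insubdK _ _ C 0 _ (restrC_subproof D0 gc).
by move=> /= ->; rewrite /= clamp_id.
Qed.

End PhaseSpace.

Section NeutralSystem.
Context {R : realType} (n p : nat) (Delta : R) (d : 'I_p -> R)
        (A : 'I_p -> 'M[R]_n) (f : C Delta n -> 'cV[R]_n).

Definition Dop (phi : C Delta n) : 'cV[R]_n :=
  phi 0 - \sum_j A j *m phi (- d j).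

(* Solutions on [0, +oo); the values of x to the left of -Delta play no role.
   The derivative of t |-> D x_t is one-sided at 0, and the last clause is its
   continuity. *)
Definition solution (xi0 : C Delta n) (x : R -> 'cV[R]_n) : Prop :=
  let Dx t := Dop (segment Delta x t) in
  let fx t := f (segment Delta x t) in
  [/\ {within `[- Delta, +oo[, continuous x},
      {in `[- Delta, 0], x =1 xi0},
      (forall t : R, 0 < t -> is_derive t (1 : R) Dx (fx t)),
      h^-1 *: (Dx h - Dx 0) @[h --> 0^'+] --> fx 0
    & {within `[0, +oo[, continuous fx}].

(* The bound is required of every solution with initial state xi0, so the
   definition does not presuppose uniqueness. *)
Definition zero_GES : Prop :=
  exists M lambda : R, [/\ 0 < M, 0 < lambda &
    forall xi0 : C Delta n,
      (exists x, solution xi0 x) /\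
      forall x, solution xi0 x -> forall t : R, 0 <= t ->
        enorm (x t) <= M * expR (- lambda * t) * cnorm xi0].

(* phi_h is [phi_shift phi h], and phi^star_theta is [phi_star phi theta]. *)
Definition phi_star (phi : C Delta n) (theta : R) : C Delta n :=
  restrC Delta (fun s => if s <= - theta then phi (s + theta) else phi 0).

Definition phi_shift (phi : C Delta n) (h : R) : C Delta n :=
  restrC Delta (fun s =>
    if s <= - h then phi (s + h)
    else Dop phi + (s + h) *: f phi - Dop (phi_star phi (s + h)) + phi 0).

(* The functions defining phi_star and phi_shift are continuous on [-Delta, 0],
   so [restrC] never returns its default value there: see [phi_starE] and
   [phi_shiftE]. *)
Lemma C_continuous (phi : C Delta n) : continuous phi.
Proof. by have /asboolP[] := CfunP phi. Qed.

Lemma C_ge0 (phi : C Delta n) s : 0 <= Delta -> 0 <= s -> phi s = phi 0.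
Proof.
move=> D0 s0; have /asboolP[_ e] := CfunP phi.
by rewrite e [RHS]e /clamp (min_idPr s0) minxx.
Qed.

Lemma phi_star_fun (phi : C Delta n) theta : 0 <= Delta ->
  (fun s => if s <= - theta then phi (s + theta) else phi 0) =
  (fun s => phi (s + theta)).
Proof.
move=> D0; apply/funext => s; case: ifPn => //; rewrite -ltNge => sh.
by rewrite C_ge0 // -lerBlDr sub0r ltW.
Qed.

Lemma shift_continuous (phi : C Delta n) h : continuous (fun s => phi (s + h)).
Proof.
move=> s; apply: (@continuous_comp _ _ _ (fun s => s + h) phi); last first.
  exact: C_continuous.
by apply: (@continuousD R R^o) => //; exact: cst_continuous.
Qed.

Lemma phi_starE (phi : C Delta n) theta : 0 <= Delta ->
  {in `[- Delta, 0], phi_star phi theta =1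
     fun s => if s <= - theta then phi (s + theta) else phi 0}.
Proof.
move=> D0; apply: restrCE => //; rewrite phi_star_fun//.
by apply: continuous_subspaceT; exact: shift_continuous.
Qed.

Lemma phi_shiftE (phi : C Delta n) h : (forall j, 0 < d j <= Delta) ->
  0 <= Delta ->
  {in `[- Delta, 0], phi_shift phi h =1 fun s =>
    if s <= - h then phi (s + h)
    else Dop phi + (s + h) *: f phi - Dop (phi_star phi (s + h)) + phi 0}.
Proof.
move=> dP D0; apply: restrCE => //; apply: continuous_subspaceT.
pose pos s := Num.max (s + h) 0.
have pos_c : continuous pos.
  move=> s; apply: (@continuous_max R R (fun s => s + h) (cst 0)).
    by apply: (@continuousD R R^o) => //; exact: cst_continuous.
  exact: cst_continuous.
pose u (theta : R) : 'cV[R]_n :=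
  Dop phi + theta *: f phi - (phi 0 - \sum_j A j *m phi (- d j + theta)).
rewrite (_ : (fun _ => _) = (fun s => phi (s + h) + u (pos s))); last first.
  apply/funext => s; rewrite /u /pos; case: ifPn => sh.
    have sh0 : s + h <= 0 by rewrite -lerBrDr sub0r.
    rewrite (max_idPr sh0) scale0r addr0 /Dop.
    by under [X in _ - (_ - X)]eq_bigr do rewrite addr0; rewrite subrr addr0.
  have sh0 : 0 <= s + h by rewrite -lerBlDr sub0r ltW// ltNge.
  rewrite (max_idPl sh0) (C_ge0 phi D0 sh0) addrC; congr (_ + (_ - _)).
  rewrite /Dop phi_starE ?in_itv/= ?lexx ?oppr_le0 ?D0//; congr (_ - _).
    by case: ifPn => // _; rewrite add0r C_ge0.
  apply: eq_bigr => j _; congr (_ *m _).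
  have /andP[dj0 djD] := dP j.
  rewrite phi_starE//; first exact: (congr1 (@^~ (- d j)) (phi_star_fun _ _ D0)).
  by rewrite in_itv/= lerN2 djD oppr_le0 ltW.
move=> s; apply: (@continuousD R _ _ (fun s => phi (s + h)) (u \o pos)).
  exact: shift_continuous.
apply: (@continuous_comp _ _ _ pos u); first exact: pos_c.
move: (pos s) => theta; rewrite /u.
apply: (@cvgB _ _ _ (nbhs theta) _ (fun t => Dop phi + t *: f phi)
  (fun t => phi 0 - \sum_j A j *m phi (- d j + t))).
  apply: (@cvgD _ _ _ (nbhs theta) _ (cst (Dop phi)) (fun t => t *: f phi)).
    exact: cvg_cst.
  exact: cvgZr_tmp.
apply: (@cvgB _ _ _ (nbhs theta) _ (cst (phi 0))
  (fun t => \sum_j A j *m phi (- d j + t))); first exact: cvg_cst.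
apply: (@cvg_big 'cV[R]_n _ _ _ _ _ R (nbhs theta) _
  (fun j t => A j *m phi (- d j + t)) (fun j => A j *m phi (- d j + theta))).
  exact: (@add_continuous 'cV[R]_n).
move=> j _; have eA t : A j *m phi (- d j + t) =
    \sum_k phi (- d j + t) k 0 *: col k (A j).
  apply/matrixP => i l; rewrite !mxE summxE; apply: eq_bigr => k _.
  by rewrite !mxE mulrC ord1.
rewrite eA (_ : (fun _ => _) = (fun t =>
    \sum_k phi (- d j + t) k 0 *: col k (A j))); last exact/funext.
apply: (@cvg_big 'cV[R]_n _ _ _ _ _ R (nbhs theta) _
  (fun k t => phi (- d j + t) k 0 *: col k (A j))
  (fun k => phi (- d j + theta) k 0 *: col k (A j))).
  exact: (@add_continuous 'cV[R]_n).
move=> k _; apply: continuousZr_tmp.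
apply: (@continuous_comp _ _ _ (fun t => phi (- d j + t)) (fun v => v k 0)).
  under [X in {for _, continuous X}]eq_fun do rewrite addrC.
  exact: shift_continuous.
exact: coord_continuous.
Qed.

Definition Dplus (V : C Delta n -> R) (phi : C Delta n) : \bar R :=
  limf_esup (fun h => ((V (phi_shift phi h) - V phi) / h)%:E) 0^'+.

End NeutralSystem.

Definition lipschitz_on_bounded (R : realType) (n : nat) (Delta : R)
    (Q : C Delta n -> 'cV[R]_n) : Prop :=
  forall H : R, 0 < H -> exists2 L : R, 0 < L &
    forall phi1 phi2 : C Delta n, cnorm phi1 <= H -> cnorm phi2 <= H ->
      enorm (Q phi1 - Q phi2) <= L * cnorm (phi1 - phi2).

Definition locally_lipschitz (R : realType) (n : nat) (Delta : R)
    (Q : C Delta n -> R) : Prop :=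
  forall phi : C Delta n, exists H L : R, [/\ 0 < H, 0 < L &
    forall phi1 phi2 : C Delta n,
      cnorm (phi1 - phi) <= H -> cnorm (phi2 - phi) <= H ->
      `|Q phi1 - Q phi2| <= L * cnorm (phi1 - phi2)].

Section StrongStability.
Context {R : realType} (n p : nat) (A : 'I_p -> 'M[R]_n).

Definition max_delay (r : 'I_p -> R) : R := \big[Num.max/0]_j r j.

(* y solves y(t) = sum_j A_j y(t - r_j), t >= sigma, and is continuous; at
   t = sigma the equation is the compatibility condition on the initial segment
   of y that continuity imposes. *)
Definition difference_solution (r : 'I_p -> R) (sigma : R) (y : R -> 'cV[R]_n)
    : Prop :=
  {within `[sigma - max_delay r, +oo[, continuous y} /\
  forall t : R, sigma <= t -> y t = \sum_j A j *m y (t - r j).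

(* Uniformity is with respect to the initial time sigma. *)
Definition zero_UAS (r : 'I_p -> R) : Prop :=
  let yseg (y : R -> 'cV[R]_n) t := segment (max_delay r) y t in
  (forall eps : R, 0 < eps -> exists2 delta : R, 0 < delta &
     forall sigma y, difference_solution r sigma y ->
       cnorm (yseg y sigma) < delta ->
       forall t : R, sigma <= t -> cnorm (yseg y t) < eps) /\
  (exists2 b : R, 0 < b &
     forall eta : R, 0 < eta -> exists2 T : R, 0 < T &
       forall sigma y, difference_solution r sigma y ->
         cnorm (yseg y sigma) < b ->
         forall t : R, sigma + T <= t -> cnorm (yseg y t) < eta).

(* Stability for all choices of positive delays, not only for the delays of the
   system. *)
Definition strongly_stable : Prop :=
  forall r : 'I_p -> R, (forall j, 0 < r j) -> zero_UAS r.

End StrongStability.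

(* Main.v *)
Require Import Defs.
From mathcomp Require Import all_boot all_order all_algebra.
From mathcomp Require Import all_classical all_reals all_analysis.
From mathcomp Require Import ring lra.

(** The bridge between the two conditions is that [Dplus] is a Dini derivative along
trajectories. For [h] below all the delays, the path [phi_shift phi h] differs
from the true state at time [h] only in the integral of [f], which it replaces by
[h *: f phi]; the error is [o(h)] ([shift_estimate]), and a locally Lipschitz [V]
does not see it ([Dplus_trajectoryP]). Both implications use this.

If [V] exists, then it decays exponentially along every trajectory
([lyapunov_decay]), and so does the difference operator, by the lower bound on
[V]. The trajectory [x] thus solves the linear difference equation
[x t = \sum_j A j *m x (t - d j) + h t] with an exponentially small forcing [h].
Stability of the homogeneous equation for the given delays makes [x] decay
exponentially as well ([difference_exponential]): attraction of the linear
equation is a contraction over one time step, and the forcing enters additively.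
This gives the estimate for every solution. A solution exists because [f],
truncated far outside the a priori bound, is globally Lipschitz; Picard iteration
in an exponentially weighted norm then converges on the whole half-line
([trajectory_exists]), and the trajectory obtained stays where the truncation
changes nothing ([lyapunov_sufficient]).

Conversely, if all solutions decay at rate [2 * mu], then [V phi] is the supremum
of [expR (mu * t) * `|x t|] along the trajectory [x] that starts at [phi], its
initial segment included. This is equivalent to the norm of [phi]. It is multiplied
by at most [expR (- mu * h)] when [phi] moves along its trajectory, by uniqueness
([lyapunov_segment_le]), and the supremum is over a time interval whose length does
not depend on [phi], so that Gronwall's inequality ([trajectory_dist_le]) makes [V]
Lipschitz on bounded sets ([lyapunov_lipschitz]).

Estimates use the maximum norm on columns, for which inequalities can be checked
coordinate by coordinate; it is equivalent to the Euclidean norm. Bounds on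
elements of the phase space are pointwise, [forall s, `|phi s| <= c]. *)

Set Implicit Arguments.
Unset Strict Implicit.
Unset Printing Implicit Defensive.

Import Order.TTheory GRing.Theory Num.Theory.
Import numFieldNormedType.Exports.

Local Open Scope classical_set_scope.
Local Open Scope ring_scope.

(** * Vectors *)

Lemma norm_col_le (R : realType) n (v : 'cV[R]_n) (c : R) :
  0 <= c -> (forall i, `|v i 0| <= c) -> `|v| <= c.
Proof.
move=> c0 vc; rewrite [leLHS]/Num.Def.normr/= mx_normrE (bigmax_le _ c0)//=.
by move=> -[i j] _ /=; rewrite (ord1 j).
Qed.

Lemma coord_norm_le (R : realType) n (v : 'cV[R]_n) i : `|v i 0| <= `|v|.
Proof.
rewrite [leRHS]/Num.Def.normr/= mx_normrE.
exact: (le_bigmax _ (fun ij => `|v ij.1 ij.2|) (i, 0)).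
Qed.

Lemma norm_le_enorm (R : realType) n (v : 'cV[R]_n) : `|v| <= enorm v.
Proof.
apply: norm_col_le => [|i]; first exact: sqrtr_ge0.
rewrite -(ler_pXn2r (ltn0Sn 1)) ?nnegrE ?normr_ge0 ?sqrtr_ge0//.
rewrite sqr_sqrtr; last by apply: sumr_ge0 => j _; exact: sqr_ge0.
rewrite real_normK ?num_real// (bigD1 i)//= lerDl.
by apply: sumr_ge0 => j _; exact: sqr_ge0.
Qed.

Lemma enorm_le_norm (R : realType) n (v : 'cV[R]_n) : enorm v <= n%:R * `|v|.
Proof.
rewrite -(ler_pXn2r (ltn0Sn 1)) ?nnegrE ?mulr_ge0 ?sqrtr_ge0//.
rewrite sqr_sqrtr; last by apply: sumr_ge0 => j _; exact: sqr_ge0.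
apply: (@le_trans _ _ (\sum_(i < n) `|v| ^+ 2)).
  apply: ler_sum => i _; rewrite -[leLHS]real_normK ?num_real//.
  by rewrite ler_sqr ?nnegrE//; exact: coord_norm_le.
rewrite sumr_const card_ord -[leLHS]mulr_natl exprMn ler_wpM2r ?sqr_ge0//.
by rewrite -natrX ler_nat; case: (n) => // k; rewrite expnS leq_pmulr.
Qed.

Lemma norm_mulmx_le (R : realType) n (B : 'M[R]_n) (v : 'cV[R]_n) :
  `|B *m v| <= n%:R * `|B| * `|v|.
Proof.
apply: norm_col_le => [|i]; first by rewrite !mulr_ge0.
rewrite mxE (le_trans (ler_norm_sum _ _ _))//.
apply: (@le_trans _ _ (\sum_(j < n) `|B| * `|v|)); last first.
  by rewrite sumr_const card_ord -[leLHS]mulr_natl mulrA.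
apply: ler_sum => j _; rewrite normrM ler_pM//; last exact: coord_norm_le.
rewrite [leRHS]/Num.Def.normr/= mx_normrE.
exact: (le_bigmax _ (fun ij => `|B ij.1 ij.2|) (i, j)).
Qed.

Lemma continuous_mulmx (R : realType) n (B : 'M[R]_n) (x : R -> 'cV[R]_n) :
  continuous x -> continuous (fun t => B *m x t).
Proof.
move=> xc t; apply/cvgrPdist_le => /= e e0.
have K0 : 0 < n%:R * `|B| + 1 :> R by rewrite ltr_wpDl// mulr_ge0.
have /cvgrPdist_le/(_ (e / (n%:R * `|B| + 1))) := xc t.
rewrite divr_gt0// => /(_ isT); apply: filterS => s /= xs.
rewrite -mulmxBr (le_trans (norm_mulmx_le _ _))//.
rewrite (@le_trans _ _ ((n%:R * `|B| + 1) * `|x t - x s|))//.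
  by rewrite ler_wpM2r// lerDl.
by rewrite mulrC -ler_pdivlMr.
Qed.

(** * Calculus of vector-valued functions of a real variable *)

Lemma is_derive_coord (R : realType) n (F : R -> 'cV[R]_n) t (v : 'cV[R]_n) i :
  is_derive t (1 : R) F v -> is_derive t (1 : R) (fun s => F s i 0) (v i 0).
Proof.
move=> [dF Fv]; have dFi := (derivable_mxP F t 1).1 dF i 0.
by apply: DeriveDef => //; rewrite -Fv derive_mx// mxE.
Qed.

Lemma is_derive_colP (R : realType) n (F : R -> 'cV[R]_n) t (v : 'cV[R]_n) :
  (forall i, is_derive t (1 : R) (fun s => F s i 0) (v i 0)) ->
  is_derive t (1 : R) F v.
Proof.
move=> h; have dF : derivable F t 1.
  by apply/derivable_mxP => i j; rewrite (ord1 j); case: (h i).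
apply: DeriveDef => //; rewrite derive_mx//; apply/matrixP => i j.
by rewrite mxE (ord1 j); case: (h i).
Qed.

(** Vector-valued mean value inequality: it reduces to the scalar one, coordinate
by coordinate, because the norm is the maximum norm. *)
Lemma mean_value_le (R : realType) n (F F' : R -> 'cV[R]_n) (G G' : R -> R)
    (a b : R) : a <= b -> continuous F -> continuous G ->
  (forall t, a < t < b -> is_derive t (1 : R) F (F' t)) ->
  (forall t, a < t < b -> is_derive t (1 : R) G (G' t)) ->
  (forall t, a < t < b -> `|F' t| <= G' t) ->
  `|F b - F a| <= G b - G a.
Proof.
move=> ab Fc Gc dF dG F'G'.
have mono (u u' : R -> R) : continuous u ->
    (forall t, a < t < b -> is_derive t (1 : R) u (u' t)) ->
    (forall t, a < t < b -> 0 <= u' t) -> u a <= u b.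
  move=> uc du u'0.
  have [||c] := @MVT_segment R u (fun t => if a < t < b then u' t else 0) a b ab.
  - by move=> t; rewrite in_itv/= => tab; rewrite tab; exact: du.
  - exact: continuous_subspaceT.
  move=> _ E; rewrite -subr_ge0 E mulr_ge0 ?subr_ge0//.
  by case: ifPn => // /u'0.
have dFi i t : a < t < b -> is_derive t (1 : R) (fun s => F s i 0) (F' t i 0).
  by move=> /dF/is_derive_coord.
have Fic i : continuous (fun s => F s i 0).
  move=> t; apply: (@continuous_comp _ _ _ F (fun v : 'cV[R]_n => v i 0)).
    exact: Fc.
  exact: coord_continuous.
have F'i i t : a < t < b -> `|F' t i 0| <= G' t.
  by move=> tab; rewrite (le_trans (coord_norm_le _ _))// F'G'.
have P i : F b i 0 - F a i 0 <= G b - G a.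
  have := mono (G - (fun s => F s i 0)) (fun t => G' t - F' t i 0).
  rewrite !fctE lerBrDr addrAC lerBlDr => h.
  rewrite lerBlDr addrAC lerBrDr addrC [leRHS]addrC; rewrite addrC in h.
  apply: h.
  - by move=> t; apply: continuousB; [exact: Gc|exact: Fic].
  - by move=> t tab; apply: is_deriveB; [exact: dG|exact: dFi].
  - by move=> t tab; rewrite subr_ge0 (le_trans (ler_norm _))// F'i.
have Q i : F a i 0 - F b i 0 <= G b - G a.
  have := mono (G + (fun s => F s i 0)) (fun t => G' t + F' t i 0).
  rewrite !fctE => h; suff : G a + F a i 0 <= G b + F b i 0 by lra.
  apply: h.
  - by move=> t; apply: continuousD; [exact: Gc|exact: Fic].
  - by move=> t tab; apply: is_deriveD; [exact: dG|exact: dFi].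
  - move=> t tab; have := F'i i t tab; rewrite ler_norml => /andP[+ _].
    by rewrite -subr_ge0 opprK addrC.
have G0 : 0 <= G b - G a.
  rewrite subr_ge0; apply: (mono _ G') => // t tab.
  exact: le_trans (F'G' t tab).
apply: norm_col_le => // i; rewrite !mxE ler_norml P andbT.
by rewrite lerNl opprB Q.
Qed.

Lemma primitive_exists (R : realType) n (g : R -> 'cV[R]_n) : continuous g ->
  exists G : R -> 'cV[R]_n, [/\ continuous G, G 0 = 0 &
    forall t : R, 0 < t -> is_derive t (1 : R) G (g t)].
Proof.
move=> gc.
pose I i (y : R) := \int[lebesgue_measure]_(t in `[- 1, y]) (g t i 0).
have gic i : continuous (fun s => g s i 0).
  move=> t; apply: (@continuous_comp _ _ _ g (fun v : 'cV[R]_n => v i 0)).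
    exact: gc.
  exact: coord_continuous.
have dI i (t : R) : 0 <= t -> is_derive t (1 : R) (I i) (g t i 0).
  move=> t0.
  have := @continuous_FTC1_closed R (fun s => g s i 0) (- 1) t (t + 1).
  case.
  - by rewrite ltrDl.
  - apply: continuous_compact_integrable; first exact: segment_compact.
    exact: continuous_subspaceT.
  - by rewrite (lt_le_trans _ t0)// ltrN10.
  - exact: gic.
  move=> dI1 dI2; suff [] : derivable (I i) t 1 /\ derive1 (I i) t = g t i 0.
    move=> {}dI1 {}dI2; split; [exact: dI1|rewrite -derive1E; exact: dI2].
  by split; [exact: dI1|exact: dI2].
pose J (t : R) : 'cV[R]_n := \col_i (I i t - I i 0).
have dJ (t : R) : 0 <= t -> is_derive t (1 : R) J (g t).
  move=> t0; apply: is_derive_colP => i.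
  rewrite (_ : (fun s => _) = I i - cst (I i 0)); last first.
    by apply/funext => s; rewrite !mxE.
  by have := @is_deriveB _ _ _ _ _ _ _ _ _ (dI i t t0) (is_derive_cst (I i 0) t 1);
    rewrite subr0.
exists (fun t : R => J (Num.max t 0)); split.
- move=> t; apply: (@continuous_comp _ _ _ (fun t : R => Num.max t 0) J).
    by apply: (@continuous_max R R id (cst 0)) => //; exact: cst_continuous.
  apply: differentiable_continuous; apply/derivable1_diffP.
  have t0 : 0 <= Num.max t 0 by rewrite le_max lexx orbT.
  by case: (dJ _ t0).
- by rewrite maxxx; apply/matrixP => i j; rewrite !mxE subrr.
- move=> t t0; apply: (@near_eq_is_derive _ _ _ J); last exact/dJ/ltW.
  near=> s; congr J; apply/esym/max_idPl.
  near: s; have : t \in `]0, +oo[ by rewrite in_itv/= t0.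
  by move=> /near_in_itvoy; apply: filterS => s; rewrite in_itv/= andbT => /ltW.
Unshelve. all: by end_near. Qed.

(** Compactness of the memory window makes the continuity of [x] uniform over it. *)
Lemma history_near (R : realType) n (Delta : R) (x : R -> 'cV[R]_n) (t e : R) :
  continuous x -> 0 < e ->
  \forall u \near t, forall s, - Delta <= s <= 0 -> `|x (t + s) - x (u + s)| <= e.
Proof.
move=> xc e0.
have /compact_near_coveringP/near_covering_withinP :=
  @segment_compact R (- Delta) 0.
pose P (u s : R) := `|x (t + s) - x (u + s)| <= e.
move=> /(_ _ (nbhs t) P _) H.
have : \forall u \near t, `[- Delta, 0] `<=` P u.
  apply: H => s _ /=.
  have /cvgrPdist_le/(_ (e / 2)) := xc (t + s).
  rewrite divr_gt0// => /(_ isT) xn.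
  have h1 : \forall s' \near s & u \near t,
      `|x (t + s) - x (u + s')| <= e / 2.
    have : (fun z : R * R => z.2 + z.1) z @[z --> (s, t)] --> t + s.
      by apply: cvgD; [exact: cvg_snd|exact: cvg_fst].
    by move=> /(_ _ xn).
  have h2 : \forall s' \near s & u \near t,
      `|x (t + s) - x (t + s')| <= e / 2.
    have : (fun z : R * R => t + z.1) z @[z --> (s, t)] --> t + s.
      by apply: cvgD; [exact: cvg_cst|exact: cvg_fst].
    by move=> /(_ _ xn).
  move: h1 h2; apply: filterS2 => -[s' u] /= h1 h2 _; rewrite /P.
  rewrite -(subrKA (x (t + s))) (le_trans (ler_normD _ _))// (splitr e) lerD//.
  by rewrite distrC.
by apply: filterS => u Pu s sD; apply: Pu; rewrite /= in_itv.
Qed.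

(** * Continuation, weighted bounds and limits *)

(** Real induction: the set of times up to which [w <= 0] is closed by continuity
and open to the right by hypothesis. *)
Lemma continuation (R : realType) (w : R -> R) (b : R) : continuous w ->
  w 0 <= 0 ->
  (forall t : R, 0 <= t < b -> (forall s : R, 0 <= s <= t -> w s <= 0) ->
    \forall h \near (0:R)^'+, w (t + h) <= 0) ->
  forall t : R, 0 <= t <= b -> w t <= 0.
Proof.
move=> wc w0 step t /andP[t0 tb].
pose S := [set t : R | 0 <= t <= b /\ forall s : R, 0 <= s <= t -> w s <= 0].
have S0 : S 0.
  split; first by rewrite lexx (le_trans t0 tb).
  by move=> s s0; have -> : s = 0 by apply/eqP; rewrite eq_le andbC.
have hS : has_sup S by split; [exists 0|exists b => s [/andP[]]].
pose c := sup S.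
have c0 : 0 <= c by apply: ub_le_sup => //; case: hS.
have cb : c <= b by apply: ge_sup; [exists 0|move=> s [/andP[]]].
have wlt s : 0 <= s < c -> w s <= 0.
  move=> /andP[s0 sc].
  have [u [_ Su] su] : exists2 u : R, S u & s < u.
    have [u Su] := @sup_adherent R S (c - s) (ltac:(rewrite subr_gt0//)) hS.
    by rewrite -/c opprB addrC subrK => su; exists u.
  by apply: Su; rewrite s0 ltW.
have wc0 : w c <= 0.
  rewrite leNgt; apply/negP => wc_gt0.
  have c_gt0 : 0 < c.
    rewrite lt_neqAle c0 andbT; apply/eqP => c0'.
    by move: wc_gt0; rewrite -c0' ltNge w0.
  have /cvgrPdist_lt/(_ _ wc_gt0) := wc c.
  move=> /nbhs_ballP[e /= e0 ce].
  pose m := Num.min e c.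
  have [m0 me mc] : [/\ 0 < m, m <= e & m <= c].
    by split; [rewrite lt_min e0|rewrite ge_min lexx|rewrite ge_min lexx orbT].
  have /ce /= : ball c e (c - m / 2) by rewrite /ball/= gtr0_norm; lra.
  have := wlt (c - m / 2); rewrite (_ : 0 <= _ < _); last by apply/andP; split; lra.
  move=> /(_ isT) w1; rewrite ltr_norml => /andP[_]; lra.
have wle (s : R) : 0 <= s <= c -> w s <= 0.
  by move=> /andP[s0]; rewrite le_eqVlt => /predU1P[->//|sc]; rewrite wlt// s0.
have [tc|ct] := leP t c; first by rewrite wle// t0.
have cb' : c < b by rewrite (lt_le_trans ct).
have := step c; rewrite c0 cb' => /(_ isT wle) => /nbhs_ballP[e /= e0 ce].
pose m := Num.min (e / 2) (b - c).
have [m0 me mb] : [/\ 0 < m, m <= e / 2 & m <= b - c].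
  split; [|by rewrite ge_min lexx|by rewrite ge_min lexx orbT].
  by rewrite lt_min divr_gt0//= subr_gt0.
suff : c + m <= c by lra.
apply: ub_le_sup; first by case: hS.
split; first by apply/andP; split; lra.
move=> s /andP[s0 scm]; have [sc|cs] := leP s c; first by rewrite wle// s0.
have := ce (s - c); rewrite [c + _]addrC subrK; apply; last by rewrite /= subr_gt0.
by rewrite /ball/= sub0r normrN gtr0_norm; lra.
Qed.

(** The least [m] with [g <= m * w], which compactness provides, improves itself to
[q + m / 2]. All Gronwall-type estimates below come from this, each with its
own weight [w]. *)
Lemma weighted_bound (R : realType) (g w : R -> R) (b q : R) :
  continuous g -> continuous w -> (forall t, 0 < w t) -> (forall t, 0 <= g t) ->
  (forall m, 0 <= m -> (forall s, 0 <= s <= b -> g s <= m * w s) ->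
    forall s, 0 <= s <= b -> g s <= (q + m / 2) * w s) ->
  forall s, 0 <= s <= b -> g s <= 2 * q * w s.
Proof.
move=> gc wc w0 g0 H s sb.
have b0 : 0 <= b by case/andP: sb => /le_trans; exact.
have [|c cb cmax] := @EVT_max R (fun t => g t / w t) 0 b b0.
  apply: continuous_subspaceT => t.
  apply: (@continuousM R R g (fun t => (w t)^-1)); first exact: gc.
  by apply: (@continuousV R R w); [rewrite gt_eqF|exact: wc].
pose m := g c / w c.
have m0 : 0 <= m by rewrite divr_ge0// ltW.
have gm t : 0 <= t <= b -> g t <= m * w t.
  by move=> tb; rewrite -ler_pdivrMr//; apply: cmax; rewrite in_itv.
have := H m m0 gm c; rewrite in_itv/= in cb; move=> /(_ cb).
rewrite -ler_pdivrMr// -/m => mq.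
by rewrite (le_trans (gm s sb))// ler_wpM2r; [|exact: ltW|lra].
Qed.

Lemma half_pow_le (R : realType) (c e : R) : 0 < e ->
  exists k : nat, c / 2 ^+ k <= e.
Proof.
move=> e0; have : (fun k => c * (2^-1) ^+ k) @ \oo --> 0.
  rewrite -[X in _ --> X](mulr0 c); apply: cvgMr.
  by apply: cvg_expr; rewrite gtr0_norm// invf_lt1// ltr1n.
move=> /cvgrPdist_lt/(_ _ e0)[N _ /(_ N)]; rewrite /= leqnn => /(_ isT).
rewrite sub0r normrN exprVn => /ltW h; exists N.
exact: le_trans (ler_norm _) h.
Qed.

Lemma geometric_limit (R : realType) n (u : nat -> 'cV[R]_n) (c : R) :
  (forall k, `|u k.+1 - u k| <= c / 2 ^+ k) ->
  exists l, forall k, `|l - u k| <= c * 2 / 2 ^+ k.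
Proof.
move=> uc.
have c0 : 0 <= c by have := uc 0; rewrite expr0 divr1; apply: le_trans.
have p0 k : 0 < 2 ^+ k :> R by rewrite exprn_gt0.
have H k m : `|u (k + m)%N - u k| <= c * 2 / 2 ^+ k - c * 2 / 2 ^+ (k + m).
  elim: m => [|m IH]; first by rewrite addn0 !subrr normr0.
  rewrite -(subrKA (u (k + m)%N)) (le_trans (ler_normD _ _))//.
  rewrite addnS (le_trans (lerD (uc _) IH))// exprS.
  have := p0 (k + m)%N; set y := 2 ^+ (k + m) => y0.
  have -> : c * 2 / (2 * y) = c / y by rewrite invfM; field; rewrite gt_eqF.
  have -> : c * 2 / y = c / y + c / y by field; rewrite gt_eqF.
  lra.
have H' k m : (k <= m)%N -> `|u m - u k| <= c * 2 / 2 ^+ k.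
  move=> km; rewrite -(subnKC km) (le_trans (H k _))// gerBl.
  by rewrite divr_ge0 ?mulr_ge0// ltW.
have cu : cvg (u @ \oo).
  apply: cauchy_cvg; apply: cauchy_exP => e e0.
  have [N Ne] := half_pow_le (c * 2) (ltac:(lra) : 0 < e / 2).
  exists (u N); exists N => // k /= Nk; rewrite -ball_normE/= distrC.
  by rewrite (le_lt_trans (H' _ _ Nk))// (le_lt_trans Ne)//; lra.
exists (lim (u @ \oo)) => k.
apply/ler_addgt0Pr => e e0.
move/cvgrPdist_le : cu => /(_ _ e0)[N _ /(_ (maxn N k))]; rewrite /= leq_maxl.
move=> /(_ isT) lu; rewrite -(subrKA (u (maxn N k))) (le_trans (ler_normD _ _))//.
by rewrite addrC lerD// H'// leq_maxr.
Qed.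

Lemma geometric_limit_continuous (R : realType) n (u : nat -> R -> 'cV[R]_n)
    (x : R -> 'cV[R]_n) (B : R -> R) :
  (forall k, continuous (u k)) -> continuous B ->
  (forall k t, `|x t - u k t| <= B t / 2 ^+ k) -> continuous x.
Proof.
move=> uc Bc xu t; apply/cvgrPdist_le => e e0.
have [k ke] := half_pow_le (B t + 1) (ltac:(lra) : 0 < e / 3).
have k0 : 0 < 2 ^+ k :> R by rewrite exprn_gt0.
have /cvgrPdist_le/(_ 1 ltr01) := Bc t.
have /cvgrPdist_le/(_ (e / 3) (ltac:(lra))) := uc k t.
apply: filterS2 => s us Bs.
have Bs1 : B s <= B t + 1 by move: Bs; rewrite ler_norml => /andP[+ _]; lra.
have h1 := xu k t; have h2 := xu k s.
have h3 : B s / 2 ^+ k <= e / 3.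
  by rewrite (le_trans _ ke)// ler_wpM2r// invr_ge0 ltW.
have h4 : B t / 2 ^+ k <= e / 3.
  by rewrite (le_trans _ ke)// ler_wpM2r ?invr_ge0 ?(ltW k0)// lerDl.
rewrite -(subrKA (u k t)) (le_trans (ler_normD _ _))//.
rewrite -[u k t - x s](subrKA (u k s)).
have := ler_normD (u k t - u k s) (u k s - x s).
rewrite [`|u k s - x s|]distrC; lra.
Qed.

(** * The phase space *)

Section PhaseSpaceTheory.
Context (R : realType) (n : nat) (Delta : R) (Delta_ge0 : 0 <= Delta).
Implicit Types (phi psi : C Delta n) (x : R -> 'cV[R]_n).

Lemma C_clamp phi s : phi s = phi (clamp Delta s).
Proof. by have /asboolP[_] := CfunP phi. Qed.

Lemma clamp_bounds s : - Delta <= clamp Delta s <= 0.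
Proof. by have := clamp_itv s Delta_ge0; rewrite in_itv. Qed.

Lemma clamp_in s : - Delta <= s <= 0 -> clamp Delta s = s.
Proof. by move=> sD; apply: clamp_id; rewrite in_itv. Qed.

Lemma C_before phi s : s <= - Delta -> phi s = phi (- Delta).
Proof.
move=> sD; rewrite C_clamp [RHS]C_clamp /clamp; congr (Cfun phi _).
rewrite (@min_idPl _ _ s 0 _); last by rewrite (le_trans sD)// oppr_le0.
rewrite (@min_idPl _ _ (- Delta) 0 _) ?oppr_le0// maxxx.
by apply/max_idPl.
Qed.

Lemma eq_C phi psi : (forall s, - Delta <= s <= 0 -> phi s = psi s) -> phi = psi.
Proof.
move=> H; apply: val_inj; apply/funext => s /=.
by rewrite C_clamp [RHS]C_clamp H// clamp_bounds.
Qed.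

Lemma restrC_continuousE (g : R -> 'cV[R]_n) s : continuous g ->
  restrC Delta g s = g (clamp Delta s).
Proof.
move=> gc; rewrite C_clamp restrCE//; last by rewrite clamp_itv.
exact: continuous_subspaceT.
Qed.

Lemma continuous_shift x (a : R) : continuous x -> continuous (fun s => x (s + a)).
Proof.
move=> xc s; apply: (@continuous_comp _ _ _ (fun s => s + a) x); last exact: xc.
by apply: (@continuousD R R^o) => //; exact: cst_continuous.
Qed.

Lemma segmentE x t s : continuous x -> segment Delta x t s = x (t + clamp Delta s).
Proof.
move=> xc; have xc' : continuous (fun tau => x (t + tau)).
  by under eq_fun do rewrite addrC; exact: continuous_shift.
exact: restrC_continuousE xc'.
Qed.

Lemma segment_shift x t h : continuous x ->
  segment Delta (fun s => x (s + h)) t = segment Delta x (t + h).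
Proof.
move=> xc; apply: eq_C => s _.
by rewrite (segmentE _ _ (continuous_shift xc)) (segmentE _ _ xc) addrAC.
Qed.

Lemma segment0 phi x : continuous x -> (forall s, s <= 0 -> x s = phi s) ->
  segment Delta x 0 = phi.
Proof.
move=> xc xphi; apply: eq_C => s sD.
by rewrite segmentE// add0r clamp_in// xphi//; case/andP: sD.
Qed.

Lemma cnorm_le phi c : (forall s, - Delta <= s <= 0 -> enorm (phi s) <= c) ->
  cnorm phi <= c.
Proof.
move=> H; apply: ge_sup; last first.
  by move=> _ [s /= sD <-]; apply: H; rewrite in_itv in sD.
by exists (enorm (phi 0)), 0 => //; rewrite /= in_itv/= lexx oppr_le0 Delta_ge0.
Qed.

Lemma cnorm_leN phi c : (forall s, `|phi s| <= c) -> cnorm phi <= n%:R * c.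
Proof.
move=> H; apply: cnorm_le => s _; rewrite (le_trans (enorm_le_norm _))//.
by rewrite ler_wpM2l.
Qed.

Lemma cnormB_le phi psi c : (forall s, `|phi s - psi s| <= c) ->
  cnorm (phi - psi) <= n%:R * c.
Proof. by move=> H; apply: cnorm_leN => s; exact: H. Qed.

Lemma enorm_le_cnorm phi s : enorm (phi s) <= cnorm phi.
Proof.
rewrite C_clamp; apply: ub_le_sup; last first.
  by exists (clamp Delta s) => //=; exact: clamp_itv.
have DN : - Delta <= 0 by rewrite oppr_le0.
have [|c _ cmax] := @EVT_max R (fun t => `|phi t|) (- Delta) 0 DN.
  apply: continuous_subspaceT => t.
  by apply: continuous_comp; [exact: C_continuous|exact: norm_continuous].
exists (n%:R * `|phi c|) => _ [t tD <-].
by rewrite (le_trans (enorm_le_norm _))// ler_wpM2l// cmax.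
Qed.

Lemma norm_le_cnorm phi s : `|phi s| <= cnorm phi.
Proof. exact: le_trans (norm_le_enorm _) (enorm_le_cnorm _ _). Qed.

Lemma cnorm_ge0 phi : 0 <= cnorm phi.
Proof. exact: le_trans (norm_le_cnorm phi 0). Qed.

End PhaseSpaceTheory.

(** * The difference operator along a path *)

Section Neutral.
Context (R : realType) (n p : nat) (d : 'I_p -> R) (A : 'I_p -> 'M[R]_n).
Implicit Types x z : R -> 'cV[R]_n.

Definition neutral x t : 'cV[R]_n := x t - \sum_j A j *m x (t - d j).

Definition delay_gain : R := \sum_j n%:R * `|A j|.

Lemma delay_gain_ge0 : 0 <= delay_gain.
Proof. by apply: sumr_ge0 => j _; rewrite mulr_ge0. Qed.

Lemma norm_delayed_le (v : 'I_p -> 'cV[R]_n) m : (forall j, `|v j| <= m) ->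
  `|\sum_j A j *m v j| <= delay_gain * m.
Proof.
move=> vm; rewrite (le_trans (ler_norm_sum _ _ _))// /delay_gain mulr_suml.
apply: ler_sum => j _; rewrite (le_trans (norm_mulmx_le _ _))//.
by rewrite ler_wpM2l// mulr_ge0.
Qed.

Lemma neutral_shift x h t : neutral (fun s => x (s + h)) t = neutral x (t + h).
Proof.
rewrite /neutral; congr (_ - _); apply: eq_bigr => j _.
by rewrite addrAC.
Qed.

Lemma neutralB x z t : neutral (fun s => x s - z s) t = neutral x t - neutral z t.
Proof.
rewrite /neutral; under eq_bigr do rewrite mulmxBr.
by rewrite big_split/= sumrN !opprD !opprK addrACA.
Qed.

Lemma continuous_delayed x :
  continuous x -> continuous (fun t => \sum_j A j *m x (t - d j)).
Proof.
move=> xc t.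
apply: (@cvg_big 'cV[R]_n _ _ _ _ _ R (nbhs t) _
  (fun j t => A j *m x (t - d j)) (fun j => A j *m x (t - d j))).
  exact: (@add_continuous 'cV[R]_n).
move=> j _; apply: (@continuous_mulmx R n (A j) (fun t => x (t - d j))).
exact: continuous_shift.
Qed.

Lemma continuous_neutral x : continuous x -> continuous (neutral x).
Proof.
move=> xc t; apply: continuousB; first exact: xc.
exact: continuous_delayed.
Qed.

Lemma norm_neutral_le x t c : (forall s, s <= t -> `|x s| <= c) ->
  (forall j, 0 <= d j) -> `|neutral x t| <= (1 + delay_gain) * c.
Proof.
move=> xc d0; rewrite (le_trans (ler_normB _ _))// mulrDl mul1r lerD ?xc//.
by apply: norm_delayed_le => j; apply: xc; rewrite gerBl.
Qed.

Lemma norm_le_neutral x t : `|x t| <=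
  `|neutral x t| + `|\sum_j A j *m x (t - d j)|.
Proof.
rewrite -[X in `|X| <= _](subrK (\sum_j A j *m x (t - d j))).
exact: ler_normD.
Qed.

Lemma delay_lower_bound : (forall j, 0 < d j) ->
  exists2 de : R, 0 < de & forall j, de <= d j.
Proof.
move=> d0; exists (\big[Num.min/1]_j d j) => [|j]; last exact: bigmin_le.
by elim/big_ind: _ => // x y x0 y0; rewrite lt_min x0.
Qed.

(** An exponential weight so steep that, measured against it, both the delayed
terms and an integral with Lipschitz constant [L] contract by a factor 1/4. *)
Definition steep (gam L : R) := [/\ 0 < gam, L / gam <= 1 / 4 &
  exists2 r : R, delay_gain * r <= 1 / 4 & forall j, expR (- gam * d j) <= r].

Lemma steep_exists L : 0 <= L -> (forall j, 0 < d j) -> exists gam, steep gam L.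
Proof.
move=> L0 /delay_lower_bound[de de0 dej].
have a0 := delay_gain_ge0.
(* The ratio is [r = 1 / (gam * de)], since [expR y >= y]. *)
pose gam := 4 * delay_gain / de + 4 * L + 1.
have a1 : 0 <= delay_gain / de by rewrite divr_ge0// ltW.
have gam0 : 0 < gam by rewrite /gam -mulrA; lra.
exists gam; split => //.
  by rewrite ler_pdivrMr// /gam -mulrA; lra.
exists ((gam * de)^-1) => [|j].
  rewrite ler_pdivrMr ?mulr_gt0// mulrA -ler_pdivrMr//.
  by rewrite /gam -mulrA; lra.
rewrite mulNr expRN lef_pV2 ?posrE ?expR_gt0 ?mulr_gt0//.
apply: (@le_trans _ _ (gam * d j)); first by rewrite ler_wpM2l// ltW.
by rewrite (le_trans _ (expR_ge1Dx _))// lerDr.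
Qed.

Lemma delayed_weighted_le gam L z t c m : steep gam L -> 0 <= c -> 0 <= m ->
  (forall j, 0 <= d j) ->
  (forall s, s <= 0 -> `|z s| <= c) ->
  (forall s, 0 <= s <= t -> `|z s| <= m * expR (gam * s)) ->
  `|\sum_j A j *m z (t - d j)| <= delay_gain * c + m / 4 * expR (gam * t).
Proof.
move=> [gam0 _ [r ar rd]] c0 m0 d0 zc zm.
apply: (@le_trans _ _ (delay_gain * (c + m * r * expR (gam * t)))).
  apply: norm_delayed_le => j.
  have r0 : 0 <= r by rewrite (le_trans _ (rd j))// expR_ge0.
  have [tj|tj] := leP (t - d j) 0.
    rewrite (le_trans (zc _ tj))// lerDl.
    by rewrite !mulr_ge0// expR_ge0.
  rewrite (le_trans (zm _ _))//; first by rewrite ltW//= gerBl.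
  have -> : gam * (t - d j) = gam * t + - gam * d j by ring.
  apply: (@le_trans _ _ (m * r * expR (gam * t))); last by rewrite lerDr.
  by rewrite expRD mulrCA mulrC ler_wpM2r ?expR_ge0// ler_wpM2l.
rewrite mulrDr lerD2l !mulrA ler_wpM2r ?expR_ge0//.
by rewrite mulrAC [leRHS]mulrC ler_wpM2r//; lra.
Qed.

(** Of a bound [m] relative to the weight, the delayed terms return [m / 4]; the
hypothesis allows [neutral z] another [m / 4]. *)
Lemma neutral_weighted_bound gam L z (b c k : R) : steep gam L ->
  (forall j, 0 <= d j) ->
  continuous z -> 0 <= c -> (forall s, s <= 0 -> `|z s| <= c) ->
  (forall m, 0 <= m -> (forall s, 0 <= s <= b -> `|z s| <= m * expR (gam * s)) ->
    forall t, 0 <= t <= b -> `|neutral z t| <= (k + m / 4) * expR (gam * t)) ->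
  forall t, 0 <= t <= b -> `|z t| <= 2 * (k + delay_gain * c) * expR (gam * t).
Proof.
move=> st d0 zc c0 zc0 H; have gam0 : 0 < gam by case: st.
apply: weighted_bound.
- move=> t; apply: continuous_comp; [exact: zc|exact: norm_continuous].
- move=> t; apply: (@continuous_comp _ _ _ (fun t => gam * t) expR).
    exact: mulrl_continuous.
  exact: continuous_expR.
- by move=> t; exact: expR_gt0.
- by [].
move=> m m0 zm t /andP[t0 tb]; rewrite (le_trans (norm_le_neutral _ _))//.
have t0b : 0 <= t <= b by rewrite t0.
have h1 := H m m0 zm t t0b.
have h2 : `|\sum_j A j *m z (t - d j)| <= delay_gain * c + m / 4 * expR (gam * t).
  apply: (delayed_weighted_le st) => // s /andP[s0 st'].
  by rewrite zm// s0 (le_trans st').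
have e1 : 1 <= expR (gam * t).
  by rewrite (le_trans _ (expR_ge1Dx _))// lerDl mulr_ge0// ltW.
have h3 : delay_gain * c <= delay_gain * c * expR (gam * t).
  by rewrite ler_peMr// mulr_ge0// delay_gain_ge0.
rewrite (le_trans (lerD h1 (le_trans h2 (lerD h3 (lexx _)))))//.
by rewrite -!mulrDl ler_wpM2r ?expR_ge0//; lra.
Qed.

End Neutral.

(** * Trajectories *)

Lemma is_derive_shift_time (R : realType) n (F : R -> 'cV[R]_n) (t h : R) v :
  is_derive (t + h) (1 : R) F v -> is_derive t (1 : R) (fun s => F (s + h)) v.
Proof.
move=> dF; apply: is_derive_colP => i.
have := @is_derive1_comp R (fun s => F s i 0) (fun s => s + h) t (v i 0) 1.
rewrite mulr1; apply; first exact: is_derive_coord.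
exact: is_derive_shift.
Qed.

Lemma is_derive_weight (R : realType) (k gam t : R) :
  is_derive t (1 : R) (fun s => k * expR (gam * s)) (k * gam * expR (gam * t)).
Proof.
have dg : is_derive t (1 : R) (fun s => gam * s) (gam * 1).
  by apply: is_deriveZ; exact: is_derive_id.
have := @is_derive1_comp R expR (fun s => gam * s) t _ _ (is_derive_expR _) dg.
move=> /(is_deriveZ k); rewrite mulr1 => h; apply: is_derive_eq h _.
by rewrite /GRing.scale/=; ring.
Qed.

Lemma continuous_weight (R : realType) (k gam : R) :
  continuous (fun s => k * expR (gam * s)).
Proof.
move=> s; apply: (@continuous_comp _ _ _ (fun t => expR (gam * t)) ( *%R k)).
  apply: (@continuous_comp _ _ _ (fun t => gam * t) expR).
    exact: mulrl_continuous.
  exact: continuous_expR.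
exact: mulrl_continuous.
Qed.

Section Trajectories.
Context (R : realType) (n p : nat) (Delta : R) (d : 'I_p -> R).
Context (A : 'I_p -> 'M[R]_n).
Context (Delta_gt0 : 0 < Delta) (d_bounds : forall j, 0 < d j <= Delta).
Implicit Types (phi psi : C Delta n) (f : C Delta n -> 'cV[R]_n).
Implicit Types x y z : R -> 'cV[R]_n.

Let Delta_ge0 : 0 <= Delta := ltW Delta_gt0.

Let d_gt0 j : 0 < d j. Proof. by case/andP: (d_bounds j). Qed.

Let d_ge0 j : 0 <= d j. Proof. exact: ltW. Qed.

Let dN_in j : - Delta <= - d j <= 0.
Proof. by rewrite lerN2 oppr_le0 d_ge0 andbT; case/andP: (d_bounds j). Qed.

Local Notation N := (neutral d A).
Local Notation a := (delay_gain A).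

Definition extends phi x := continuous x /\ forall s, s <= 0 -> x s = phi s.

(** Solutions as paths over the whole line, constant before [- Delta]: then
continuity needs no domain, and [neutral] is differentiated on open intervals
only. *)
Definition trajectory f phi x := extends phi x /\
  forall t : R, 0 < t -> is_derive t (1 : R) (N x) (f (segment Delta x t)).

Lemma Dop_segment x t : continuous x -> Dop d A (segment Delta x t) = N x t.
Proof.
move=> xc; rewrite /Dop /neutral (segmentE Delta_ge0 _ _ xc).
rewrite clamp_in ?lexx ?andbT ?oppr_le0// addr0; congr (_ - _).
apply: eq_bigr => j _; rewrite (segmentE Delta_ge0 _ _ xc) clamp_in//.
Qed.

Lemma neutral0 phi x : extends phi x -> N x 0 = Dop d A phi.
Proof.
by move=> [xc xphi]; rewrite -Dop_segment// (segment0 Delta_ge0 xc xphi).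
Qed.

Lemma norm_segmentB_le x y t m : continuous x -> continuous y ->
  (forall s, - Delta <= s <= 0 -> `|x (t + s) - y (t + s)| <= m) ->
  forall s, `|segment Delta x t s - segment Delta y t s| <= m.
Proof.
move=> xc yc H s; rewrite (segmentE Delta_ge0 _ _ xc) (segmentE Delta_ge0 _ _ yc).
by apply: H; exact: clamp_bounds.
Qed.

(** Gronwall's inequality for the neutral equation: relative to a steep weight, the
delayed terms and the integral of the right-hand side each return at most a
quarter of the distance. *)
Lemma trajectory_dist_le f phi psi x y gam L (b c : R) : steep d A gam L ->
  0 <= L -> 0 <= c ->
  trajectory f phi x -> trajectory f psi y ->
  (forall s, `|phi s - psi s| <= c) ->
  (forall t m, 0 < t < b ->
    (forall s, `|segment Delta x t s - segment Delta y t s| <= m) ->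
    `|f (segment Delta x t) - f (segment Delta y t)| <= L * m) ->
  forall t, 0 <= t <= b -> `|x t - y t| <= (3 + 4 * a) * c * expR (gam * t).
Proof.
move=> st L0 c0 [[xc xphi] dx] [[yc ypsi] dy] hc fL.
have [gam0 Lgam _] := st.
pose z t := x t - y t.
have zc : continuous z by move=> t; apply: continuousB; [exact: xc|exact: yc].
have z0 s : s <= 0 -> `|z s| <= c by move=> s0; rewrite /z xphi// ypsi.
move=> t tb; have a0 := @delay_gain_ge0 R n p A.
pose k := (1 + a) * c + c / 4.
have -> : (3 + 4 * a) * c = 2 * (k + a * c) + c / 2 by rewrite /k; lra.
rewrite (@le_trans _ _ (2 * (k + a * c) * expR (gam * t)))//; last first.
  by rewrite ler_wpM2r ?expR_ge0// lerDl divr_ge0.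
move: t tb; apply: (neutral_weighted_bound st d_ge0 zc c0 z0).
move=> m m0 zm t /andP[t0 tb].
have e1 s : 0 <= s -> 1 <= expR (gam * s).
  by move=> s0; rewrite (le_trans _ (expR_ge1Dx _))// lerDl mulr_ge0// ltW.
have zall s : s <= b -> `|z s| <= (c + m) * expR (gam * Num.max s 0).
  move=> sb; have [s0|s0] := leP s 0.
    rewrite mulr0 expR0 mulr1 (le_trans (z0 _ s0))// lerDl//.
  rewrite (le_trans (zm s _)) ?(ltW s0)//.
  by rewrite ler_wpM2r ?expR_ge0// lerDr.
pose W (s : R) := (c + m) * (L / gam) * expR (gam * s).
have := @mean_value_le R n (N z)
  (fun s => f (segment Delta x s) - f (segment Delta y s)) W
  (fun s => (c + m) * L * expR (gam * s)) 0 t t0.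
have Nz0 : `|N z 0| <= (1 + a) * c by exact: norm_neutral_le.
move=> MV; have {}MV : `|N z t - N z 0| <= W t - W 0.
  apply: MV.
  - exact: continuous_neutral.
  - exact: continuous_weight.
  - move=> s /andP[s0 _].
    rewrite (_ : N z = N x - N y); last first.
      by apply/funext => u; rewrite neutralB.
    by apply: is_deriveB; [exact: dx|exact: dy].
  - move=> s _; apply: is_derive_eq (is_derive_weight _ _ _) _.
    by congr (_ * _); field; rewrite gt_eqF.
  - move=> s /andP[s0 st']; rewrite [_ * L]mulrC -mulrA.
    apply: fL; first by rewrite s0 (lt_le_trans st').
    apply: norm_segmentB_le => // u /andP[_ u0].
    have sub : s + u <= b by apply: (@le_trans _ _ t) => //; lra.
    rewrite (le_trans (zall _ sub))// ler_wpM2l ?addr_ge0// ler_expR ler_pM2l//.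
    by rewrite ge_max (ltW s0) andbT gerDl.
have W0 : 0 <= W 0 by rewrite /W !mulr_ge0 ?addr_ge0 ?expR_ge0 ?invr_ge0// ltW.
have Wt : W t <= (c / 4 + m / 4) * expR (gam * t).
  rewrite /W ler_wpM2r ?expR_ge0//.
  have -> : c / 4 + m / 4 = (c + m) * (1 / 4) by field.
  by rewrite ler_wpM2l ?addr_ge0.
have h1 : (1 + a) * c <= (1 + a) * c * expR (gam * t).
  by rewrite ler_peMr ?e1// mulr_ge0// addr_ge0.
rewrite -[N z t](subrK (N z 0)) (le_trans (ler_normD _ _))//.
rewrite (le_trans (lerD MV Nz0))// /k; lra.
Qed.

(** * Global existence for globally Lipschitz right-hand sides *)

Definition lipschitz_with L f := forall phi psi m,
  (forall s, `|phi s - psi s| <= m) -> `|f phi - f psi| <= L * m.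

Definition lipschitz_on_balls f := forall H : R, exists2 L : R, 0 < L &
  forall phi psi m, (forall s, `|phi s| <= H) -> (forall s, `|psi s| <= H) ->
  (forall s, `|phi s - psi s| <= m) -> `|f phi - f psi| <= L * m.

Lemma continuous_along f x : lipschitz_on_balls f -> continuous x ->
  continuous (fun t => f (segment Delta x t)).
Proof.
move=> fL xc t.
pose H := cnorm (segment Delta x t) + 1.
have [L L0 HL] := fL H.
have xH s : `|segment Delta x t s| <= cnorm (segment Delta x t).
  exact: norm_le_cnorm.
apply/cvgrPdist_le => e e0.
have e1 : 0 < Num.min 1 (e / L) by rewrite lt_min ltr01 divr_gt0.
apply: filterS (history_near Delta t xc e1) => u xu.
have xu' s : `|segment Delta x t s - segment Delta x u s| <= Num.min 1 (e / L).
  rewrite !(segmentE Delta_ge0 _ _ xc); apply: xu; exact: clamp_bounds.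
rewrite (le_trans (HL _ _ (Num.min 1 (e / L)) _ _ _))//.
- by move=> s; rewrite (le_trans (xH s))// lerDl.
- move=> s; rewrite -(subrK (segment Delta x t s) (segment Delta x u s)).
  rewrite (le_trans (ler_normD _ _))// addrC lerD// distrC.
  by rewrite (le_trans (xu' s))// ge_min lexx.
- by rewrite mulrC -ler_pdivlMr// ge_min lexx orbT.
Qed.

Lemma lipschitz_with_on_balls f L : 0 <= L -> lipschitz_with L f ->
  lipschitz_on_balls f.
Proof.
move=> L0 fL H; exists (L + 1) => [|phi psi m _ _ h].
  by rewrite ltr_wpDl.
rewrite (le_trans (fL _ _ _ h))// ler_wpM2r ?lerDl//.
exact: le_trans (h 0).
Qed.

(** One step of Picard iteration, where [G] is the integral of [f] along [x]. *)
Definition picard f phi x y := exists G : R -> 'cV[R]_n,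
  [/\ continuous G, G 0 = 0,
      forall t : R, 0 < t -> is_derive t (1 : R) G (f (segment Delta x t)) &
      forall t, 0 <= t -> y t = Dop d A phi + G t + \sum_j A j *m x (t - d j)].

Lemma picard_exists f phi x : lipschitz_on_balls f -> extends phi x ->
  exists y, extends phi y /\ picard f phi x y.
Proof.
move=> fL [xc xphi].
have [G [Gc G0 dG]] := primitive_exists (continuous_along fL xc).
pose S t := \sum_j A j *m x (t - d j).
have Sc : continuous S by exact: continuous_delayed.
have pc : continuous (fun t : R => Num.max t 0).
  move=> t; apply: (@continuous_max R R id (cst 0)) => //.
  exact: cst_continuous.
have D0 : Dop d A phi = phi 0 - S 0.
  congr (_ - _); apply: eq_bigr => j _; rewrite sub0r xphi//.
  by rewrite oppr_le0.
pose u t := Dop d A phi + G t + S t - phi 0.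
have uc : continuous u.
  move=> t; apply: (@continuousB R 'cV[R]_n R (fun t => Dop d A phi + G t + S t)
    (cst (phi 0))); last exact: cst_continuous.
  apply: (@continuousD R 'cV[R]_n R (fun t => Dop d A phi + G t) S); last first.
    exact: Sc.
  by apply: continuousD; [exact: cst_continuous|exact: Gc].
exists (fun t : R => phi t + u (Num.max t 0)); split; first split.
- move=> t; apply: (@continuousD R 'cV[R]_n R phi (fun t : R => u (Num.max t 0))).
    exact: C_continuous.
  apply: (@continuous_comp _ _ _ (fun t : R => Num.max t 0) u); first exact: pc.
  exact: uc.
- by move=> s s0; rewrite (max_idPr s0) /u D0 G0 addr0 subrK subrr addr0.
exists G; split => // t t0; rewrite (max_idPl t0) /u (C_ge0 _ Delta_ge0 t0).
by rewrite addrC subrK.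
Qed.

(** A steep weight makes the step a contraction on the whole half-line, so that no
continuation from one time interval to the next is needed. *)
Lemma picard_contracts f phi x1 x2 y1 y2 gam L m : steep d A gam L -> 0 <= L ->
  lipschitz_with L f -> extends phi x1 -> extends phi x2 ->
  picard f phi x1 y1 -> picard f phi x2 y2 ->
  (forall s, 0 <= s -> `|x1 s - x2 s| <= m * expR (gam * s)) ->
  forall s, 0 <= s -> `|y1 s - y2 s| <= m / 2 * expR (gam * s).
Proof.
move=> st L0 fL [x1c x1phi] [x2c x2phi] [G1 [G1c G10 dG1 y1E]]
  [G2 [G2c G20 dG2 y2E]] xm t t0.
have [gam0 Lgam _] := st.
have m0 : 0 <= m.
  by have := xm 0 (lexx _); rewrite mulr0 expR0 mulr1; exact: le_trans.
pose W (s : R) := m * (L / gam) * expR (gam * s).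
have z0 s : s <= 0 -> `|x1 s - x2 s| <= 0.
  by move=> s0; rewrite x1phi// x2phi// subrr normr0.
have GW : `|(G1 t - G2 t) - (G1 0 - G2 0)| <= W t - W 0.
  apply: (@mean_value_le R n (G1 - G2)
    (fun s => f (segment Delta x1 s) - f (segment Delta x2 s)) W
    (fun s => m * L * expR (gam * s)) 0 t t0).
  - by move=> s; apply: continuousB; [exact: G1c|exact: G2c].
  - exact: continuous_weight.
  - by move=> s /andP[s0 _]; apply: is_deriveB; [exact: dG1|exact: dG2].
  - move=> s _; apply: is_derive_eq (is_derive_weight _ _ _) _.
    by congr (_ * _); field; rewrite gt_eqF.
  - move=> s /andP[s0 st']; rewrite [_ * L]mulrC -mulrA.
    apply: fL; apply: norm_segmentB_le => // u /andP[_ u0].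
    have [su|su] := leP (s + u) 0.
      by rewrite (le_trans (z0 _ su))// mulr_ge0// expR_ge0.
    rewrite (le_trans (xm _ (ltW su)))// ler_wpM2l// ler_expR ler_pM2l//.
    by rewrite gerDl.
have W0 : 0 <= W 0 by rewrite /W !mulr_ge0 ?expR_ge0 ?invr_ge0// ltW.
have Wt : W t <= m / 4 * expR (gam * t).
  rewrite /W ler_wpM2r ?expR_ge0//.
  have -> : m / 4 = m * (1 / 4) by field.
  by rewrite ler_wpM2l.
have SW : `|\sum_j A j *m (x1 (t - d j) - x2 (t - d j))| <=
    a * 0 + m / 4 * expR (gam * t).
  apply: (delayed_weighted_le (z := fun s => x1 s - x2 s) st) => // s.
  by move=> /andP[s0 _]; exact: xm.
have -> : y1 t - y2 t = (G1 t - G2 t) - (G1 0 - G2 0) +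
    \sum_j A j *m (x1 (t - d j) - x2 (t - d j)).
  under eq_bigr do rewrite mulmxBr.
  rewrite big_split/= sumrN y1E// y2E// G10 G20 !subr0.
  move: (\sum_j _) (\sum_j _) (G1 t) (G2 t) (Dop d A phi) => S1 S2 g1 g2 D.
  by apply/matrixP => i j; rewrite !mxE; ring.
rewrite (le_trans (ler_normD _ _))// (le_trans (lerD GW SW))//; lra.
Qed.

(** The iterates converge geometrically, locally uniformly in time, and the
contraction property shows that the limit is a fixed point. *)
Lemma trajectory_exists f phi L : 0 <= L -> lipschitz_with L f ->
  exists x, trajectory f phi x.
Proof.
move=> L0 fL.
have fB := lipschitz_with_on_balls L0 fL.
have [gam st] := steep_exists A L0 d_gt0.
have [gam0 _ _] := st.
have /choice[P HP] : forall x, exists y,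
    extends phi x -> extends phi y /\ picard f phi x y.
  move=> x; have [xe|xe] := pselect (extends phi x); last by exists x.
  by have [y] := picard_exists fB xe; exists y.
pose u k := iter k P phi.
have phie : extends phi phi by split=> // t; exact: C_continuous.
have ue k : extends phi (u k).
  by elim: k => [|k IH] //=; have [] := HP _ IH.
have uP k : picard f phi (u k) (u k.+1) by have [] := HP _ (ue k).
have a0 := @delay_gain_ge0 R n p A.
(* The first step grows at most linearly, hence at most like the weight. *)
have [c c0 u0] : exists2 c, 0 <= c &
    forall t, 0 <= t -> `|u 1%N t - u 0%N t| <= c * expR (gam * t).
  pose K := cnorm phi.
  have K0 : 0 <= K by exact: cnorm_ge0.
  have phiK s : `|phi s| <= K by exact: norm_le_cnorm.
  pose B := `|f 0| + L * K.
  have B0 : 0 <= B by rewrite addr_ge0// mulr_ge0.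
  have [G [Gc G0 dG u1E]] := uP 0%N.
  exists (2 * (1 + a) * K + B / gam) => [|t t0].
    by rewrite addr_ge0 ?divr_ge0 ?(ltW gam0)// !mulr_ge0// addr_ge0.
  have GB : `|G t - G 0| <= B * t - B * 0.
    apply: (@mean_value_le R n G (fun s => f (segment Delta phi s))
      (fun s => B * s) (fun s => B) 0 t t0) => //.
    - exact: mulrl_continuous.
    - by move=> s /andP[s0 _]; exact: dG.
    - move=> s _; have := @is_deriveZ _ _ _ id B s 1 1 (is_derive_id s 1).
      by move=> h; apply: is_derive_eq h _; rewrite /GRing.scale/= mulr1.
    - move=> s _; rewrite -[f _](subrK (f 0)) (le_trans (ler_normD _ _))//.
      rewrite addrC lerD2l fL// => v.
      rewrite subr0 (segmentE Delta_ge0 _ _ (@C_continuous _ _ _ phi)).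
      exact: phiK.
  rewrite G0 subr0 mulr0 subr0 in GB.
  have Bt : B * t <= B / gam * expR (gam * t).
    rewrite -mulrA ler_wpM2l// mulrC ler_pdivlMr// mulrC.
    by rewrite (le_trans _ (expR_ge1Dx _))// lerDr.
  have SK : `|\sum_j A j *m phi (t - d j)| <= a * K by exact: norm_delayed_le.
  have DK : `|Dop d A phi| <= (1 + a) * K.
    rewrite -(@neutral0 phi phi)//.
    by apply: norm_neutral_le.
  have e1 : 1 <= expR (gam * t).
    by rewrite (le_trans _ (expR_ge1Dx _))// lerDl mulr_ge0// ltW.
  rewrite u1E//= (le_trans (ler_normB _ _))//.
  rewrite (le_trans (lerD (ler_normD _ _) (phiK t)))//.
  rewrite (le_trans (lerD (lerD (ler_normD _ _) SK) (lexx _)))//.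
  have : 2 * (1 + a) * K <= 2 * (1 + a) * K * expR (gam * t).
    by rewrite ler_peMr// !mulr_ge0// addr_ge0.
  lra.
have uc k t : `|u k.+1 t - u k t| <= c * expR (gam * t) / 2 ^+ k.
  have [t0|t0] := leP 0 t; last first.
    rewrite (ue k.+1).2 ?(ltW t0)// (ue k).2 ?(ltW t0)// subrr normr0.
    by rewrite divr_ge0 ?exprn_ge0// mulr_ge0// expR_ge0.
  rewrite mulrAC.
  elim: k t t0 => [|k IH] t t0; first by rewrite expr0 divr1 u0.
  have -> : c / 2 ^+ k.+1 = c / 2 ^+ k / 2.
    by rewrite exprSr; field; rewrite expf_neq0.
  exact: (picard_contracts st L0 fL (ue k.+1) (ue k) (uP k.+1) (uP k) IH t0).
have [x xu] := choice (fun t => geometric_limit (fun k => uc k t)).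
have xc : continuous x.
  apply: (@geometric_limit_continuous R n u x (fun t => c * expR (gam * t) * 2)).
  - by move=> k; case: (ue k).
  - move=> t; apply: (@continuousM R R (fun t => c * expR (gam * t)) (cst 2)).
      exact: continuous_weight.
    exact: cst_continuous.
  - by move=> k t; exact: xu.
have xe : extends phi x.
  split=> // s s0; apply/eqP; rewrite -subr_eq0 -normr_le0.
  apply/ler_addgt0Pr => e e0; rewrite add0r.
  have [k ke] := half_pow_le (c * expR (gam * s) * 2) e0.
  by rewrite (le_trans _ ke)// -((ue k).2 s s0) xu.
have [y [ye xy]] := picard_exists fB xe.
have yx t : 0 <= t -> y t = x t.
  move=> t0; apply/eqP; rewrite -subr_eq0 -normr_le0.
  apply/ler_addgt0Pr => e e0; rewrite add0r.
  have [k ke] := half_pow_le (2 * (c * expR (gam * t) * 2)) e0.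
  rewrite -(subrKA (u k.+1 t)) (le_trans (ler_normD _ _))// (le_trans _ ke)//.
  have k0 : 0 < 2 ^+ k :> R by rewrite exprn_gt0.
  have h1 : `|y t - u k.+1 t| <= (c * 2 / 2 ^+ k) / 2 * expR (gam * t).
    apply: (picard_contracts st L0 fL xe (ue k) xy (uP k)) => // s s0.
    have -> : c * 2 / 2 ^+ k * expR (gam * s) =
        c * expR (gam * s) * 2 / 2 ^+ k by ring.
    exact: xu.
  have h2 := xu t k.+1; rewrite distrC in h2.
  rewrite (le_trans (lerD h1 h2))// exprS invfM.
  set w := (2 ^+ k)^-1; have w0 : 0 <= w by rewrite invr_ge0 ltW.
  have := mulr_ge0 (mulr_ge0 c0 (expR_ge0 (gam * t))) w0.
  lra.
exists x; split => // t t0.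
have [G [Gc G0 dG yE]] := xy.
have dDG : is_derive t (1 : R) (cst (Dop d A phi) + G) (f (segment Delta x t)).
  by rewrite -[f _]add0r; apply: is_deriveD; exact: dG.
apply: near_eq_is_derive dDG.
have : t \in `]0, +oo[ by rewrite in_itv/= t0.
move=> /near_in_itvoy; apply: filterS => s; rewrite in_itv/= andbT => s0.
by rewrite /neutral -yx ?(ltW s0)// yE ?(ltW s0)// addrK.
Qed.

End Trajectories.

(** * Exponential estimates from strong stability *)

Section Stability.
Context (R : realType) (n p : nat) (Delta : R) (d : 'I_p -> R).
Context (A : 'I_p -> 'M[R]_n).
Context (Delta_gt0 : 0 < Delta) (d_bounds : forall j, 0 < d j <= Delta).
Implicit Types (phi psi : C Delta n) (f : C Delta n -> 'cV[R]_n).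
Implicit Types x y z : R -> 'cV[R]_n.

Let Delta_ge0 : 0 <= Delta := ltW Delta_gt0.

Let d_gt0 j : 0 < d j. Proof. by case/andP: (d_bounds j). Qed.

Let d_ge0 j : 0 <= d j. Proof. exact: ltW. Qed.

Local Notation N := (neutral d A).
Local Notation a := (delay_gain A).

(** Forgetting the values before the memory window turns any continuous path into
one that extends an element of the phase space. *)
Definition freeze x (s : R) : 'cV[R]_n := x (Num.max (- Delta) s).

Lemma freezeE x s : - Delta <= s -> freeze x s = x s.
Proof. by move=> /max_idPr sD; rewrite /freeze sD. Qed.

Lemma freeze_within_continuous x : {within `[- Delta, +oo[, continuous x} ->
  continuous (freeze x).
Proof.
move=> xc s.
have sD (u : R) : `[- Delta, +oo[%classic (Num.max (- Delta) u).
  by rewrite /= in_itv/= andbT le_max lexx.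
have /subspace_continuousP/(_ _ (sD s)) := xc.
move=> h; apply: cvg_comp h => B /=; rewrite /within/= => nB.
have mc : continuous (fun s : R => Num.max (- Delta) s).
  by move=> u; apply: (@continuous_max R R (cst (- Delta)) id) => //;
    exact: cst_continuous.
have := mc s _ nB; rewrite /nbhs/=.
by apply: (@filterS _ (nbhs s)) => u /=; apply; exact: sD.
Qed.

Lemma freeze_continuous x : continuous x -> continuous (freeze x).
Proof.
by move=> xc; apply: freeze_within_continuous; exact: continuous_subspaceT.
Qed.

Lemma freeze_extends x : continuous x -> extends (segment Delta x 0) (freeze x).
Proof.
move=> xc; split=> [|s s0]; first exact: freeze_continuous.
rewrite (segmentE Delta_ge0 _ _ xc) add0r /clamp /freeze.
by rewrite (min_idPl s0).
Qed.

Lemma neutral_freeze x t : 0 <= t -> N (freeze x) t = N x t.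
Proof.
move=> t0; rewrite /neutral freezeE ?(le_trans _ t0) ?oppr_le0//; congr (_ - _).
apply: eq_bigr => j _; rewrite freezeE//.
by have /andP[_ dD] := d_bounds j; rewrite lerBrDr addrC -lerBrDr opprK ler_wpDl.
Qed.

Lemma segment_freeze x t : continuous x -> 0 <= t ->
  segment Delta (freeze x) t = segment Delta x t.
Proof.
move=> xc t0; apply: (eq_C Delta_ge0) => s /andP[sD s0].
rewrite (segmentE Delta_ge0 _ _ xc).
rewrite (segmentE Delta_ge0 _ _ (freeze_continuous xc)) freezeE//.
rewrite clamp_in ?sD//; lra.
Qed.

(** By linearity, attraction of one ball of initial states into an arbitrarily small
ball is contraction by an arbitrarily small factor. *)
Lemma difference_contraction (e : R) : 0 < e -> zero_UAS A d ->
  exists2 T : R, 0 < T & forall y c, continuous y ->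
    (forall t, 0 <= t -> N y t = 0) ->
    (forall s, s <= 0 -> `|y s| <= c) -> forall t, T <= t -> `|y t| <= e * c.
Proof.
move=> e0 [_ [b b0 H]].
have n0 : 0 < n%:R + 1 :> R by rewrite ltr_wpDl.
pose r := b / (2 * (n%:R + 1)).
have r0 : 0 < r by rewrite divr_gt0 ?mulr_gt0.
have [T T0 HT] := H (e * r) (mulr_gt0 e0 r0).
exists T => // y c yc Ny yc0 t Tt.
have c0 : 0 <= c by rewrite (le_trans _ (yc0 0 (lexx _))).
apply/ler_addgt0Pr => e' e'0.
pose c' := c + e' / e.
have c'0 : 0 < c' by rewrite ltr_wpDl// divr_gt0.
have -> : e * c + e' = e * c' by rewrite /c'; field; rewrite gt_eqF.
pose k := r / c'.
have k0 : 0 < k by rewrite divr_gt0.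
pose y' t := k *: y t.
have y'c : continuous y'.
  by move=> s; apply: continuousZl_tmp; exact: yc.
have D0 : 0 <= max_delay d.
  by rewrite /max_delay; elim/big_ind: _ => // u v u0 v0; rewrite le_max u0.
have y'sol : difference_solution A d 0 y'.
  split; first exact: continuous_subspaceT.
  move=> s s0; have := Ny s s0; rewrite /neutral => /eqP; rewrite subr_eq0.
  move=> /eqP ys; rewrite /y' [in LHS]ys scaler_sumr.
  by apply: eq_bigr => j _; rewrite scalemxAr.
have := HT 0 y' y'sol _ t; rewrite add0r => HT'.
have {}HT' : cnorm (segment (max_delay d) y' t) < e * r.
  apply: HT' => //.
  have : forall s, `|segment (max_delay d) y' 0 s| <= r.
    move=> s; rewrite (segmentE D0 _ _ y'c) add0r normrZ gtr0_norm//.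
    rewrite /k mulrAC ler_pdivrMr// ler_wpM2l ?(ltW r0)//.
    rewrite (le_trans (yc0 _ _))//; last by rewrite lerDl divr_ge0// ltW.
    by case/andP: (clamp_bounds D0 s).
  move=> /(cnorm_leN D0)/le_lt_trans; apply.
  rewrite /r mulrA ltr_pdivrMr ?mulr_gt0// mulrC ltr_pM2l//.
  lra.
have := le_lt_trans (norm_le_cnorm D0 (segment (max_delay d) y' t) 0) HT'.
rewrite (segmentE D0 _ _ y'c) clamp_in ?lexx ?andbT ?oppr_le0// addr0.
rewrite normrZ gtr0_norm// /k mulrAC ltr_pdivrMr// => h.
by rewrite ltW// -(ltr_pM2l r0) mulrCA mulrA.
Qed.

(** The witness is a tent of height [v] at [0], so narrow that it vanishes at every
delay. *)
Lemma Dop_section (v : 'cV[R]_n) : exists phi : C Delta n,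
  Dop d A phi = v /\ forall s, `|phi s| <= `|v|.
Proof.
have [de de0 dej] := delay_lower_bound d_gt0.
pose hat (s : R) := Num.max 0 (1 + s / de).
have hc : continuous hat.
  move=> s; apply: (@continuous_max R R (cst 0) (fun s => 1 + s / de)).
    exact: cst_continuous.
  apply: (@continuousD R R R (cst 1) (fun s => s / de)).
    exact: cst_continuous.
  exact: mulrr_continuous.
have hvc : continuous (fun s => hat s *: v).
  by move=> s; apply: continuousZr_tmp; exact: hc.
have hv s : restrC Delta (fun s => hat s *: v) s = hat (clamp Delta s) *: v.
  by rewrite (restrC_continuousE Delta_ge0 _ hvc).
exists (restrC Delta (fun s => hat s *: v)); split.
  rewrite /Dop hv clamp_in ?lexx ?andbT ?oppr_le0//.
  rewrite {1}/hat mul0r addr0 (max_idPr ler01) scale1r big1 ?subr0// => j _.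
  have /andP[dj0 djD] := d_bounds j.
  rewrite hv clamp_in ?lerN2 ?djD ?oppr_le0 ?ltW//.
  rewrite /hat (max_idPl _) ?scale0r ?mulmx0//.
  by rewrite -lerBrDl sub0r ler_pdivrMr// mulN1r lerN2.
move=> s; rewrite hv normrZ.
have /andP[_ s0] := clamp_bounds Delta_ge0 s.
rewrite ger0_norm ?le_max ?lexx// ler_piMl// /hat ge_max ler01/=.
by rewrite gerDl pmulr_lle0 ?invr_gt0.
Qed.

Lemma DopB phi psi : Dop d A (phi - psi) = Dop d A phi - Dop d A psi.
Proof.
rewrite /Dop (_ : \sum_j A j *m (phi - psi) (- d j) =
    \sum_j A j *m phi (- d j) - \sum_j A j *m psi (- d j)).
  rewrite (_ : (phi - psi) 0 = phi 0 - psi 0)//.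
  move: (\sum_j _) (\sum_j _) => S1 S2.
  by apply/matrixP => i j; rewrite !mxE; ring.
rewrite -sumrB; apply: eq_bigr => j _; rewrite -mulmxBr.
by [].
Qed.

(** Superposition: a homogeneous solution that starts at distance at most
[`|N x 0|] from [x] is contracted, and what remains starts small and is driven
by [N x] alone. *)
Lemma difference_step : zero_UAS A d ->
  exists T K : R, [/\ 0 < T, 0 <= K & forall x c k, continuous x ->
    (forall s, - Delta <= s <= 0 -> `|x s| <= c) ->
    (forall t, 0 <= t <= T -> `|N x t| <= k) ->
    `|x T| <= c / 4 + K * k].
Proof.
move=> /(@difference_contraction (1 / 4) (ltac:(lra)))[T T0 HT].
have [gam st] := steep_exists A (lexx 0) d_gt0.
have a0 := @delay_gain_ge0 R n p A.
exists T, (1 / 4 + 2 * (1 + a) * expR (gam * T)); split => //.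
  by rewrite addr_ge0// !mulr_ge0 ?expR_ge0// addr_ge0.
move=> x c k xc xb Nk.
have k0 : 0 <= k by rewrite (le_trans _ (Nk 0 _))// lexx ltW.
have xe := freeze_extends xc.
set phi := segment Delta x 0 in xe.
have phic s : `|phi s| <= c.
  by rewrite (segmentE Delta_ge0 _ _ xc) add0r; exact/xb/clamp_bounds.
have phiD : Dop d A phi = N x 0 by rewrite Dop_segment.
have [th [thD thv]] := Dop_section (N x 0).
have thk s : `|th s| <= k by rewrite (le_trans (thv s))// Nk// lexx ltW.
pose psi := phi - th.
have psiD : Dop d A psi = 0 by rewrite DopB phiD thD subrr.
have psib s : `|psi s| <= c + k.
  by rewrite (le_trans (ler_normB (phi s) (th s)))// lerD.
have zL : lipschitz_with 0 (fun _ : C Delta n => 0 : 'cV[R]_n).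
  by move=> *; rewrite subrr normr0 mul0r.
have [y [ye dy]] := trajectory_exists A Delta_gt0 d_bounds psi (lexx 0) zL.
have yc := ye.1.
have Ny t : 0 <= t -> N y t = 0.
  move=> t0; rewrite -[RHS]psiD -(neutral0 A Delta_gt0 d_bounds ye).
  apply/eqP; rewrite -subr_eq0 -normr_le0.
  rewrite -[leRHS](subrr (0 : R)).
  apply: (@mean_value_le R n (N y) (fun=> 0) (fun=> 0) (fun=> 0) 0 t t0) => //.
  - exact: continuous_neutral.
  - exact: cst_continuous.
  - by move=> s /andP[s0 _]; exact: dy.
  - by move=> s _; rewrite normr0.
have yT : `|y T| <= 1 / 4 * (c + k).
  by apply: HT => // s s0; rewrite ye.2.
pose z s := freeze x s - y s.
have zT : `|z T| <= 2 * (k + a * k) * expR (gam * T).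
  apply: (@neutral_weighted_bound R n p d A gam 0 z T k k st d_ge0) => //.
  - by move=> s; apply: continuousB; [exact: xe.1|exact: yc].
  - move=> s s0; rewrite /z xe.2// ye.2//.
    by rewrite (_ : psi s = phi s - th s)// opprB addrC subrK.
  - move=> m m0 _ t /andP[t0 tT].
    rewrite neutralB Ny// subr0 neutral_freeze// (le_trans (Nk t _)) ?t0//.
    have e1 : 1 <= expR (gam * t).
      rewrite (le_trans _ (expR_ge1Dx _))// lerDl mulr_ge0// ltW//.
      by case: st.
    rewrite (@le_trans _ _ (k + m / 4))// ?lerDl ?divr_ge0// ler_peMr//.
    by rewrite addr_ge0// divr_ge0.
  - by rewrite lexx ltW.
have -> : x T = y T + z T.
  by rewrite /z addrC subrK freezeE// (le_trans _ (ltW T0))// oppr_le0.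
rewrite (le_trans (ler_normD _ _))// (le_trans (lerD yT zT))//; lra.
Qed.

(** In the weight [expR (- lam * t)] the contraction over one step absorbs half
of any bound, which leaves a bound by the data alone. *)
Lemma difference_exponential (al : R) : zero_UAS A d -> 0 < al ->
  exists M lam : R, [/\ 0 < M, 0 < lam & forall x b c k, continuous x ->
    (forall s, s <= 0 -> `|x s| <= c) ->
    (forall t, 0 <= t <= b -> `|N x t| <= k * expR (- al * t)) ->
    forall t, 0 <= t <= b -> `|x t| <= M * (c + k) * expR (- lam * t)].
Proof.
move=> /difference_step[T [K [T0 K0 HT]]] al0.
have [gam st] := steep_exists A (lexx 0) d_gt0.
have [gam0 _ _] := st.
have a0 := @delay_gain_ge0 R n p A.
have TD : 0 < T + Delta by rewrite addr_gt0.
pose lam := Num.min al (ln 2 / (T + Delta)).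
have lam0 : 0 < lam by rewrite lt_min al0 divr_gt0// ln_gt0// ltr1n.
have lam_al : lam <= al by rewrite ge_min lexx.
have lamT : expR (lam * (T + Delta)) <= 2.
  rewrite -[leRHS]lnK ?posrE ?ltr0n// ler_expR -ler_pdivlMr//.
  by rewrite ge_min lexx orbT.
pose Q := 1 + 2 * K + 4 * (1 + a) * expR (gam * T).
have G0 : 0 <= 4 * (1 + a) * expR (gam * T).
  by rewrite !mulr_ge0 ?expR_ge0 ?addr_ge0.
have Q0 : 0 < Q by rewrite /Q; lra.
exists (2 * Q), lam; split => //; first by rewrite mulr_gt0.
move=> x b c k xc xc0 Nk t tb.
have c0 : 0 <= c by rewrite (le_trans _ (xc0 0 _)).
have b0 : 0 <= b by case/andP: tb => /le_trans; exact.
have k0 : 0 <= k.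
  have := Nk 0; rewrite lexx b0 mulr0 expR0 mulr1 => /(_ isT).
  exact: le_trans.
rewrite -[2 * Q * _]mulrA.
move: t tb.
apply: (@weighted_bound R (fun t => `|x t|) (fun t => expR (- lam * t))).
- by move=> t; apply: continuous_comp; [exact: xc|exact: norm_continuous].
- move=> t; apply: (@continuous_comp _ _ _ (fun t => - lam * t) expR).
    exact: mulrl_continuous.
  exact: continuous_expR.
- by move=> t; exact: expR_gt0.
- by [].
move=> m m0 xm t /andP[t0 tb].
have ew : 0 <= expR (- lam * t) by exact: expR_ge0.
have ck0 : 0 <= c + k by rewrite addr_ge0.
(* The choice of [lam]: looking back by [T + Delta] costs a factor 2. *)
have sh u : t - (T + Delta) <= u -> expR (- lam * u) <= 2 * expR (- lam * t).
  move=> ut; apply: (@le_trans _ _ (expR (lam * (T + Delta)) * expR (- lam * t))).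
    rewrite -expRD ler_expR !mulNr.
    have : lam * (t - (T + Delta)) <= lam * u by rewrite ler_pM2l.
    lra.
  by rewrite ler_wpM2r.
have [tT|Tt] := leP t T.
  have h : `|x t| <= 2 * (k + a * c) * expR (gam * t).
    apply: (@neutral_weighted_bound R n p d A gam 0 x b c k st d_ge0) => //;
      last by rewrite t0.
    move=> m' m'0 _ s /andP[s0 sb].
    rewrite (le_trans (Nk s _)) ?s0// ler_pM ?expR_ge0//.
      by rewrite lerDl divr_ge0.
    by rewrite ler_expR mulNr; have := mulr_ge0 (ltW al0) s0;
      have := mulr_ge0 (ltW gam0) s0; lra.
  have e1 : 1 <= 2 * expR (- lam * t).
    by have := sh 0; rewrite mulr0 expR0; apply; have := Delta_gt0; lra.
  have e2 : expR (gam * t) <= expR (gam * T) by rewrite ler_expR ler_pM2l.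
  have h1 : 2 * (k + a * c) <= 2 * (1 + a) * (c + k).
    by have := mulr_ge0 a0 k0; lra.
  have h2 : `|x t| <= 2 * (1 + a) * (c + k) * expR (gam * T).
    rewrite (le_trans h)// ler_pM ?expR_ge0//.
    by rewrite mulr_ge0// addr_ge0// mulr_ge0.
  have h3 : `|x t| <= 2 * (1 + a) * (c + k) * expR (gam * T) *
      (2 * expR (- lam * t)).
    rewrite (le_trans h2)// ler_peMr// !mulr_ge0 ?expR_ge0// addr_ge0//.
  rewrite (le_trans h3)//.
  have -> : 2 * (1 + a) * (c + k) * expR (gam * T) * (2 * expR (- lam * t)) =
    4 * (1 + a) * expR (gam * T) * (c + k) * expR (- lam * t) by ring.
  rewrite ler_wpM2r//.
  have : 0 <= (1 + 2 * K) * (c + k) by rewrite mulr_ge0// addr_ge0// mulr_ge0.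
  rewrite /Q; lra.
pose x' s := x (s + (t - T)).
have := HT x' (2 * (c + m) * expR (- lam * t)) (2 * k * expR (- lam * t)).
rewrite /x' (_ : T + (t - T) = t); last by ring.
move=> H; apply: (le_trans (H _ _ _)).
- exact: continuous_shift.
- move=> s /andP[sD s0].
  have su : expR (- lam * (s + (t - T))) <= 2 * expR (- lam * t).
    by apply: sh; lra.
  rewrite -mulrA mulrCA.
  have [u0|u0] := leP (s + (t - T)) 0.
    rewrite (le_trans (xc0 _ u0))//.
    have h1 : 1 <= expR (- lam * (s + (t - T))).
      rewrite -expR0 ler_expR mulNr -mulrN mulr_ge0 ?(ltW lam0)//; lra.
    rewrite (@le_trans _ _ (c * (2 * expR (- lam * t))))//.
      by rewrite ler_peMr// (le_trans h1).
    by rewrite ler_wpM2r ?lerDl// mulr_ge0.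
  rewrite (le_trans (xm _ _))//; first by rewrite (ltW u0)/=; lra.
  rewrite (@le_trans _ _ (m * (2 * expR (- lam * t))))//.
    by rewrite ler_wpM2l.
  by rewrite ler_wpM2r ?lerDr// mulr_ge0.
- move=> s /andP[s0 sT]; rewrite (neutral_shift d A x).
  rewrite (le_trans (Nk _ _))//; first by apply/andP; split; lra.
  rewrite -mulrA mulrCA ler_wpM2l//.
  rewrite (@le_trans _ _ (expR (- lam * (s + (t - T)))))//; last first.
    by apply: sh; have := Delta_gt0; lra.
  by rewrite ler_expR !mulNr lerN2 ler_wpM2r//; lra.
have -> : 2 * (c + m) * expR (- lam * t) / 4 + K * (2 * k * expR (- lam * t)) =
  ((c + m) / 2 + K * 2 * k) * expR (- lam * t) by field.
rewrite ler_wpM2r//.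
have : 0 <= 4 * (1 + a) * expR (gam * T) * (c + k) by rewrite mulr_ge0.
have := mulr_ge0 K0 c0.
rewrite /Q; lra.
Qed.

End Stability.

(** * Dini derivatives along trajectories *)

Lemma near_right0 (R : realType) (P : R -> Prop) :
  (\forall h \near (0 : R), P h) -> \forall h \near (0 : R)^'+, P h.
Proof. exact: cvg_within. Qed.

(** Comparison with the strict supersolutions
[u 0 * expR (- al * t) + e * (1 + t)]: to cross one of them, [u] would have to
grow faster than the bound on its upper right Dini derivative allows. *)
Lemma dini_decay (R : realType) (u : R -> R) (al b : R) : 0 < al ->
  continuous u -> 0 <= u 0 ->
  (forall t, 0 <= t < b -> forall e, 0 < e ->
    \forall h \near (0 : R)^'+, u (t + h) - u t <= h * (- al * u t + e)) ->
  forall t, 0 <= t <= b -> u t <= u 0 * expR (- al * t).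
Proof.
move=> al0 uc u0 du t /andP[t0 tb].
apply/ler_addgt0Pr => e e0.
have t1 : 0 < 1 + t by rewrite ltr_wpDr.
pose ep := e / (1 + t); have ep0 : 0 < ep by rewrite divr_gt0.
pose v (s : R) := u 0 * expR (- al * s) + ep * (1 + s).
have vc : continuous v.
  move=> s; apply: (@continuousD R R R (fun s => u 0 * expR (- al * s))
    (fun s => ep * (1 + s))); first exact: continuous_weight.
  apply: (@continuousM R R (cst ep) (fun s => 1 + s)).
    exact: cst_continuous.
  apply: (@continuousD R R R (cst 1) id) => //; exact: cst_continuous.
suff : u t - v t <= 0.
  by rewrite subr_le0 /v /ep divfK// gt_eqF.
apply: (@continuation R (fun s => u s - v s) b); last by rewrite t0.
- by move=> s; apply: continuousB; [exact: uc|exact: vc].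
- by rewrite /v mulr0 expR0; lra.
move=> s /andP[s0 sb] us.
have {us} := us s; rewrite s0 lexx => /(_ isT).
rewrite le_eqVlt => /predU1P[usv|usv].
  have ep2 : 0 < ep / 2 by rewrite divr_gt0.
  have := du s _ (ep / 2) ep2; rewrite s0 sb => /(_ isT) dus.
  near=> h.
  have h0 : 0 < h by near: h; exact: nbhs_right_gt.
  have uh : u (s + h) - u s <= h * (- al * u s + ep / 2) by near: h.
  have eh : 1 - al * h <= expR (- al * h).
    by rewrite (le_trans _ (expR_ge1Dx _))// mulNr.
  rewrite mulNr in eh.
  have esh : u 0 * expR (- al * s) * (1 - al * h) <= u 0 * expR (- al * (s + h)).
    have -> : - al * (s + h) = - al * s + - al * h by ring.
    rewrite expRD [leRHS]mulrA ler_wpM2l// ?mulNr//.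
    by rewrite mulr_ge0// expR_ge0.
  have p1 : 0 <= al * h * (ep * (1 + s)).
    apply: mulr_ge0; first exact: mulr_ge0 (ltW al0) (ltW h0).
    by apply: mulr_ge0 (ltW ep0) _; exact: addr_ge0.
  have p2 : 0 < h * ep by rewrite mulr_gt0.
  move: usv uh; rewrite /v => usv.
  have -> : u s = u 0 * expR (- al * s) + ep * (1 + s) by lra.
  by move: esh; set E := u 0 * expR (- al * s); set E' := u 0 * _; lra.
have : \forall h \near (0 : R), u (s + h) - v (s + h) < 0.
  have wc : (fun h => u (s + h) - v (s + h)) h @[h --> 0] --> u (s + 0) - v (s + 0).
    have sc : continuous (fun h => s + h).
      move=> h; apply: (@continuousD R R R (cst s) id) => //.
      exact: cst_continuous.
    apply: (@continuousB R R R (fun h => u (s + h)) (fun h => v (s + h))).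
      apply: (@continuous_comp _ _ _ (fun h => s + h) u); [exact: sc|exact: uc].
    apply: (@continuous_comp _ _ _ (fun h => s + h) v); [exact: sc|exact: vc].
  move/cvgrPdist_lt : wc => /(_ (v s - u s)); rewrite addr0 subr_gt0 -subr_lt0 usv.
  by move=> /(_ isT); apply: filterS => h; rewrite ltr_norml => /andP[+ _]; lra.
by move=> /near_right0; apply: filterS => h /ltW.
Unshelve. all: by end_near. Qed.

Section Dini.
Context (R : realType) (n p : nat) (Delta : R) (d : 'I_p -> R).
Context (A : 'I_p -> 'M[R]_n).
Context (Delta_gt0 : 0 < Delta) (d_bounds : forall j, 0 < d j <= Delta).
Implicit Types (phi psi : C Delta n) (f : C Delta n -> 'cV[R]_n).
Implicit Types (x y z : R -> 'cV[R]_n) (V : C Delta n -> R).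

Let Delta_ge0 : 0 <= Delta := ltW Delta_gt0.

Let d_gt0 j : 0 < d j. Proof. by case/andP: (d_bounds j). Qed.

Let d_ge0 j : 0 <= d j. Proof. exact: ltW. Qed.

Local Notation N := (neutral d A).

Lemma Dplus_leP f V phi (c : R) : (Dplus d A f V phi <= c%:E)%E <->
  forall e, 0 < e -> \forall h \near (0 : R)^'+,
    V (phi_shift d A f phi h) - V phi <= h * (c + e).
Proof.
rewrite /Dplus limf_esupE; split=> [Vc e e0|H].
  have : (c%:E < (c + e)%:E)%E by rewrite lte_fin ltrDl.
  move=> /(le_lt_trans Vc)/ereal_inf_lt[_ [W W0 <-]] sW.
  near=> h.
  have h0 : 0 < h by near: h; exact: nbhs_right_gt.
  have Wh : W h by near: h.
  rewrite mulrC -ler_pdivrMr// -lee_fin (le_trans _ (ltW sW))//.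
  by apply: ereal_sup_ubound; exists h.
apply/lee_addgt0Pr => e e0.
apply: (@le_trans _ _ (ereal_sup [set ((V (phi_shift d A f phi h) - V phi) / h)%:E |
   h in [set h | 0 < h /\ V (phi_shift d A f phi h) - V phi <= h * (c + e)]])).
  apply: ereal_inf_lbound; eexists; last reflexivity.
  near=> h; split; first by near: h; exact: nbhs_right_gt.
  by near: h; exact: H.
apply: ge_ereal_sup => _ [h [h0 hV] <-].
by rewrite -EFinD lee_fin ler_pdivrMr// mulrC.
Unshelve. all: by end_near. Qed.

Lemma trajectory_shift f phi x t : 0 <= t -> trajectory d A f phi x ->
  trajectory d A f (segment Delta x t) (freeze Delta (fun s => x (s + t))).
Proof.
move=> t0 [[xc xphi] dx].
have xtc : continuous (fun s => x (s + t)) by exact: continuous_shift.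
split.
  have := freeze_extends Delta_gt0 xtc.
  by rewrite (segment_shift Delta_ge0 0 t xc) add0r.
move=> s s0; rewrite (segment_freeze Delta_gt0 xtc (ltW s0)) segment_shift//.
have dN : is_derive s (1 : R) (N (fun s => x (s + t)))
    (f (segment Delta x (s + t))).
  have := is_derive_shift_time (dx (s + t) (ltr_wpDr t0 s0)).
  by under eq_fun do rewrite -neutral_shift.
apply: near_eq_is_derive dN.
have : s \in `]0, +oo[ by rewrite in_itv/= s0.
move=> /near_in_itvoy; apply: filterS => u; rewrite in_itv/= andbT => u0.
by rewrite (neutral_freeze A Delta_gt0 d_bounds) ?ltW.
Qed.

Lemma phi_star_val phi th s : - Delta <= s <= 0 -> phi_star phi th s = phi (s + th).
Proof.
move=> sD; rewrite phi_starE ?in_itv//.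
exact: (congr1 (@^~ s) (phi_star_fun phi th Delta_ge0)).
Qed.

(** The derivative at time [0] is one-sided only, so that the expansion comes from
the mean value inequality and the continuity of [f] along the trajectory. *)
Lemma neutral_expansion f phi x e : lipschitz_on_balls f ->
  trajectory d A f phi x -> 0 < e -> \forall h \near (0 : R)^'+,
    forall th, 0 <= th <= h -> `|N x th - N x 0 - th *: f phi| <= e * th.
Proof.
move=> fL [xe dx] e0; have [xc xphi] := xe.
have fc := continuous_along Delta_gt0 fL xc.
have s0E : segment Delta x 0 = phi by exact: segment0.
have /cvgrPdist_le/(_ e e0)/nbhs_ballP[r /= r0 Hr] := fc 0.
near=> h => th.
have hr : h < r by near: h; exact: nbhs_right_lt.
move=> /andP[th0 thh].
have -> : N x th - N x 0 - th *: f phi =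
   (N x th - th *: f phi) - (N x 0 - 0 *: f phi).
  by rewrite scale0r subr0 addrAC.
rewrite -[leRHS]subr0 -[X in _ <= _ - X](mulr0 e).
have zc : continuous (fun s : R => s *: f phi).
  by move=> s; apply: continuousZr_tmp.
apply: (@mean_value_le R n (N x - (fun s => s *: f phi))
  (fun s => f (segment Delta x s) - f phi) (fun s => e * s) (fun=> e) 0 th th0).
- move=> s; apply: (@continuousB R _ R (N x) (fun s => s *: f phi)).
    exact: continuous_neutral.
  exact: zc.
- exact: mulrl_continuous.
- move=> s /andP[s0 _]; apply: is_deriveB; first exact: dx.
  apply: is_derive_colP => i.
  rewrite (_ : (fun s => _) = (fun s => s * f phi i 0)); last first.
    by apply/funext => u; rewrite mxE.
  have h1 := @is_deriveZ _ _ _ id (f phi i 0) s 1 1 (is_derive_id s 1).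
  rewrite (_ : (fun s => _) = f phi i 0 *: id); last first.
    by apply/funext => u; rewrite mulrC.
  by apply: is_derive_eq h1 _; rewrite /GRing.scale/= mulr1.
- move=> s _; have := @is_deriveZ _ _ _ id e s 1 1 (is_derive_id s 1).
  by move=> h1; apply: is_derive_eq h1 _; rewrite /GRing.scale/= mulr1.
- move=> s /andP[s0 sth]; rewrite -s0E distrC; apply: Hr.
  by rewrite /ball/= sub0r normrN gtr0_norm// (lt_trans sth)// (le_lt_trans thh).
Unshelve. all: by end_near. Qed.

(** Over a time [h] shorter than every delay the path [phi_shift] differs from the
trajectory only by the error of the first-order expansion of the integral
of [f]. *)
Lemma shift_estimate f phi x e : lipschitz_on_balls f -> trajectory d A f phi x ->
  0 < e -> \forall h \near (0 : R)^'+,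
    forall s, `|segment Delta x h s - phi_shift d A f phi h s| <= e * h.
Proof.
move=> fL xt e0; have [[xc xphi] _] := xt.
near=> h.
have h0 : 0 < h by near: h; exact: nbhs_right_gt.
have key th : 0 <= th <= h -> `|N x th - N x 0 - th *: f phi| <= e * th.
  by move: th; near: h; exact: neutral_expansion.
have hd j : h <= d j.
  move: j; near: h; apply: filter_forall => j.
  exact: nbhs_right_le.
move=> s; rewrite C_clamp// [X in _ - X]C_clamp//.
have := clamp_bounds Delta_ge0 s; move: (clamp Delta s) => {}s sD.
have /andP[sDl s0] := sD.
rewrite (segmentE Delta_ge0 _ _ xc) clamp_in// phi_shiftE//.
case: ifPn => sh.
  rewrite [h + s]addrC xphi; last by lra.
  by rewrite subrr normr0 mulr_ge0 ?ltW.
rewrite -ltNge in sh.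
have th0 : 0 <= s + h by lra.
have -> : x (h + s) = N x (s + h) + \sum_j A j *m x (s + h - d j).
  by rewrite /neutral subrK addrC.
have -> : Dop d A (phi_star phi (s + h)) = phi 0 - \sum_j A j *m x (s + h - d j).
  rewrite /Dop phi_star_val ?lexx ?oppr_le0 ?Delta_ge0// add0r C_ge0//.
  congr (_ - _); apply: eq_bigr => j _; congr (_ *m _).
  have /andP[dj0 djD] := d_bounds j.
  rewrite phi_star_val ?lerN2 ?djD ?oppr_le0 ?(ltW dj0)//.
  by rewrite addrC xphi// subr_le0 (le_trans _ (hd j))// gerDr.
rewrite -(neutral0 A Delta_gt0 d_bounds xt.1).
move: (key (s + h)); rewrite th0 gerDr s0 => /(_ isT) k.
rewrite (le_trans _ (_ : e * (s + h) <= e * h))//; last first.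
  by rewrite ler_wpM2l ?(ltW e0)// gerDr.
apply: le_trans k; rewrite le_eqVlt; apply/orP; left; apply/eqP; congr (`|_|).
move: (\sum_j _) (N x _) (N x 0) (f phi) (phi 0) => S n1 n2 g u.
by apply/matrixP => i j; rewrite !mxE; ring.
Unshelve. all: by end_near. Qed.

Lemma segment_near x t e : continuous x -> 0 < e ->
  \forall u \near t, cnorm (segment Delta x u - segment Delta x t) <= e.
Proof.
move=> xc e0; have n0 : 0 < n%:R + 1 :> R by rewrite ltr_wpDl.
have e1 : 0 < e / (n%:R + 1) by rewrite divr_gt0.
apply: filterS (history_near Delta t xc e1) => u xu.
apply: (@le_trans _ _ (n%:R * (e / (n%:R + 1)))).
  apply: (cnormB_le Delta_ge0) => s; rewrite !(segmentE Delta_ge0 _ _ xc) distrC.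
  by apply: xu; exact: clamp_bounds.
by rewrite mulrA ler_pdivrMr// mulrC ler_pM2l// lerDl.
Qed.

Lemma lyapunov_continuous V x : locally_lipschitz V -> continuous x ->
  continuous (fun t => V (segment Delta x t)).
Proof.
move=> VL xc t; have [H [L [H0 L0 HL]]] := VL (segment Delta x t).
apply/cvgrPdist_le => e e0.
have e1 : 0 < Num.min H (e / L) by rewrite lt_min H0 divr_gt0.
apply: filterS (segment_near t xc e1) => u xu.
have xuH : cnorm (segment Delta x u - segment Delta x t) <= H.
  by rewrite (le_trans xu)// ge_min lexx.
have xtH : cnorm (segment Delta x t - segment Delta x t) <= H.
  apply: (@le_trans _ _ (n%:R * 0)); last by rewrite mulr0 ltW.
  by apply: (cnormB_le Delta_ge0) => s; rewrite subrr normr0.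
rewrite distrC; apply: (le_trans (HL _ _ xuH xtH)).
by rewrite mulrC -ler_pdivlMr// (le_trans xu)// ge_min lexx orbT.
Qed.

Lemma lyapunov_shift_near f V phi x e : lipschitz_on_balls f ->
  locally_lipschitz V -> trajectory d A f phi x -> 0 < e ->
  \forall h \near (0 : R)^'+,
    `|V (segment Delta x h) - V (phi_shift d A f phi h)| <= e * h.
Proof.
move=> fL VL xt e0; have [[xc xphi] _] := xt.
have [H [L [H0 L0 HL]]] := VL phi.
have n0 : 0 < n%:R + 1 :> R by rewrite ltr_wpDl.
have r0 : 0 < e / (L * (n%:R + 1)) by rewrite divr_gt0// mulr_gt0.
have s0E : segment Delta x 0 = phi by exact: segment0.
have H2 : 0 < H / 2 / (n%:R + 1) by rewrite !divr_gt0.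
near=> h.
have h0 : 0 < h by near: h; exact: nbhs_right_gt.
have E s : `|segment Delta x h s - phi_shift d A f phi h s| <=
    e / (L * (n%:R + 1)) * h.
  by move: s; near: h; exact: shift_estimate.
have P s : `|segment Delta x h s - phi s| <= H / 2 / (n%:R + 1).
  rewrite -s0E !(segmentE Delta_ge0 _ _ xc) distrC.
  have := clamp_bounds Delta_ge0 s; move: (clamp Delta s) => {}s.
  by move: s; near: h; apply: near_right0; exact: history_near.
have small : e / (L * (n%:R + 1)) * h <= H / 2 / (n%:R + 1).
  rewrite mulrC -ler_pdivlMr//; near: h; apply: nbhs_right_le.
  by rewrite divr_gt0.
have n1 (c : R) : 0 <= c -> n%:R * (c / (n%:R + 1)) <= c.
  by move=> c0; rewrite mulrA ler_pdivrMr// mulrC ler_wpM2l// lerDl.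
have c1 : cnorm (segment Delta x h - phi) <= H.
  apply: (le_trans (cnormB_le Delta_ge0 P)); apply: (le_trans (n1 _ _)); lra.
have c2 : cnorm (phi_shift d A f phi h - phi) <= H.
  apply: (@le_trans _ _ (n%:R * (H / (n%:R + 1)))); last by apply: n1; exact: ltW.
  apply: (cnormB_le Delta_ge0) => s.
  rewrite -(subrKA (segment Delta x h s)) (le_trans (ler_normD _ _))//.
  have -> : H / (n%:R + 1) = H / 2 / (n%:R + 1) + H / 2 / (n%:R + 1).
    by field; rewrite gt_eqF.
  by rewrite lerD// distrC (le_trans (E s)).
apply: (le_trans (HL _ _ c1 c2)).
apply: (le_trans (ler_wpM2l (ltW L0) (cnormB_le Delta_ge0 E))).
have -> : L * (n%:R * (e / (L * (n%:R + 1)) * h)) = n%:R * (e * h / (n%:R + 1)).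
  by field; rewrite !gt_eqF.
by apply: n1; rewrite mulr_ge0// ltW.
Unshelve. all: by end_near. Qed.

(** [Dplus] is the Dini derivative along the trajectory: a locally Lipschitz
functional does not see the difference between the two paths. *)
Lemma Dplus_trajectoryP f V phi x (c : R) : lipschitz_on_balls f ->
  locally_lipschitz V -> trajectory d A f phi x ->
  (Dplus d A f V phi <= c%:E)%E <->
  forall e, 0 < e -> \forall h \near (0 : R)^'+,
    V (segment Delta x h) - V phi <= h * (c + e).
Proof.
move=> fL VL xt.
have near2 e : 0 < e -> \forall h \near (0 : R)^'+,
    `|V (segment Delta x h) - V (phi_shift d A f phi h)| <= e / 2 * h.
  by move=> e0; apply: lyapunov_shift_near => //; rewrite divr_gt0.
split=> [/Dplus_leP H e e0|H].
  have e2 : 0 < e / 2 by rewrite divr_gt0.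
  apply: filterS2 (near2 e e0) (H _ e2) => h.
  by rewrite ler_norml => /andP[_]; lra.
apply/Dplus_leP => e e0; have e2 : 0 < e / 2 by rewrite divr_gt0.
apply: filterS2 (near2 e e0) (H _ e2) => h.
by rewrite ler_norml => /andP[+ _]; lra.
Qed.

Lemma lyapunov_decay f V phi x (al b : R) : 0 < al -> lipschitz_on_balls f ->
  locally_lipschitz V -> 0 <= V phi -> trajectory d A f phi x ->
  (forall t, 0 <= t < b ->
    (Dplus d A f V (segment Delta x t) <= (- al * V (segment Delta x t))%:E)%E) ->
  forall t, 0 <= t <= b -> V (segment Delta x t) <= V phi * expR (- al * t).
Proof.
move=> al0 fL VL V0 xt H t tb; have [[xc xphi] _] := xt.
have s0E : segment Delta x 0 = phi by exact: segment0.
rewrite -s0E.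
apply: (@dini_decay R (fun t => V (segment Delta x t)) al b) => //.
- exact: lyapunov_continuous.
- by rewrite s0E.
move=> {tb}t /andP[t0 tb] e e0; have := H t; rewrite t0 tb => /(_ isT).
have xtt := trajectory_shift t0 xt.
move=> /(Dplus_trajectoryP _ fL VL xtt)/(_ e e0).
apply: filterS2 (nbhs_right_gt 0) => h h0.
have xtc : continuous (fun s => x (s + t)) by exact: continuous_shift.
rewrite (segment_freeze Delta_gt0 xtc (ltW h0)).
by rewrite (segment_shift Delta_ge0 h t xc) addrC [h + t]addrC addrC.
Qed.

End Dini.

(** * Truncation of the right-hand side *)

Section Truncation.
Context (R : realType) (n : nat) (Delta : R) (Delta_ge0 : 0 <= Delta) (H : R).
Context (H_ge0 : 0 <= H).
Implicit Types (phi psi : C Delta n) (f : C Delta n -> 'cV[R]_n).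

Definition cap (r : R) : R := Num.max (- H) (Num.min r H).

Lemma cap_bound r : `|cap r| <= H.
Proof.
rewrite ler_norml /cap le_max lexx/= ge_max ge_min lexx orbT andbT.
by rewrite (le_trans _ H_ge0)// oppr_le0.
Qed.

Lemma cap_id r : `|r| <= H -> cap r = r.
Proof.
by rewrite ler_norml /cap => /andP[r1 r2]; rewrite (min_idPl r2) (max_idPr r1).
Qed.

Lemma cap_lipschitz r s : `|cap r - cap s| <= `|r - s|.
Proof.
wlog sr : r s / s <= r => [W|].
  by have [/W//|/ltW/W] := leP s r; rewrite distrC [in leRHS]distrC.
rewrite [leRHS]ger0_norm ?subr_ge0// ler_norml /cap.
by rewrite /Num.max /Num.min; do 4 case: ifPn; rewrite -?leNgt; lra.
Qed.

Definition cap_col (v : 'cV[R]_n) : 'cV[R]_n := \col_i cap (v i 0).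

Lemma cap_col_lipschitz u v : `|cap_col u - cap_col v| <= `|u - v|.
Proof.
apply: norm_col_le => // i; rewrite !mxE (le_trans (cap_lipschitz _ _))//.
by have := coord_norm_le (u - v) i; rewrite !mxE.
Qed.

Definition trunc phi : C Delta n := restrC Delta (cap_col \o phi).

Lemma truncE phi s : trunc phi s = cap_col (phi s).
Proof.
have cc : continuous (cap_col \o phi).
  move=> t; apply/cvgrPdist_le => e e0.
  have /cvgrPdist_le/(_ e e0) := @C_continuous _ _ _ phi t.
  by apply: filterS => u; apply: le_trans; exact: cap_col_lipschitz.
by rewrite (restrC_continuousE Delta_ge0 _ cc) /= -C_clamp.
Qed.

Lemma trunc_id phi : (forall s, `|phi s| <= H) -> trunc phi = phi.
Proof.
move=> phiH; apply: (eq_C Delta_ge0) => s _; rewrite truncE.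
apply/matrixP => i j; rewrite mxE (ord1 j) cap_id//.
exact: le_trans (coord_norm_le _ _) (phiH s).
Qed.

Lemma trunc_lipschitz f : lipschitz_on_balls f ->
  exists2 L : R, 0 <= L & lipschitz_with L (f \o trunc).
Proof.
move=> /(_ H)[L L0 HL]; exists L; first exact: ltW.
have tb phi s : `|trunc phi s| <= H.
  rewrite truncE; apply: norm_col_le => // i; rewrite mxE; exact: cap_bound.
move=> phi psi m pm; apply: HL => // s.
by rewrite !truncE (le_trans (cap_col_lipschitz _ _)).
Qed.

End Truncation.

Lemma lipschitz_on_bounded_balls (R : realType) n (Delta : R)
    (f : C Delta n -> 'cV[R]_n) : 0 <= Delta ->
  lipschitz_on_bounded f -> lipschitz_on_balls f.
Proof.
move=> D0 fL H.
pose H' := n%:R * `|H| + 1.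
have H'0 : 0 < H' by rewrite ltr_wpDl// mulr_ge0.
have [L L0 HL] := fL H' H'0.
exists (L * (n%:R + 1)); first by rewrite mulr_gt0// ltr_wpDl.
have cH (phi : C Delta n) : (forall s, `|phi s| <= H) -> cnorm phi <= H'.
  move=> pH; rewrite (le_trans (cnorm_leN D0 pH))// /H'.
  rewrite (@le_trans _ _ (n%:R * `|H|))// ?lerDl//.
  by rewrite ler_wpM2l// ler_norm.
move=> phi psi m /cH pH /cH sH pm.
have m0 : 0 <= m by rewrite (le_trans _ (pm 0)).
apply: (le_trans (norm_le_enorm _)); apply: (le_trans (HL _ _ pH sH)).
rewrite -mulrA ler_wpM2l ?(ltW L0)//; apply: (le_trans (cnormB_le D0 pm)).
by rewrite ler_wpM2r// lerDl.
Qed.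

(** * Solutions and trajectories *)

Section Equivalence.
Context (R : realType) (n p : nat) (Delta : R) (d : 'I_p -> R).
Context (A : 'I_p -> 'M[R]_n).
Context (Delta_gt0 : 0 < Delta) (d_bounds : forall j, 0 < d j <= Delta).
Implicit Types (phi psi : C Delta n) (f : C Delta n -> 'cV[R]_n).
Implicit Types (x y z : R -> 'cV[R]_n) (V : C Delta n -> R).

Let Delta_ge0 : 0 <= Delta := ltW Delta_gt0.

Local Notation N := (neutral d A).
Local Notation a := (delay_gain A).

Lemma solution_trajectory f phi x :
  solution d A f phi x -> trajectory d A f phi (freeze Delta x).
Proof.
move=> [xc xphi dx _ _].
have fc := freeze_within_continuous xc.
have sE t : 0 <= t -> segment Delta (freeze Delta x) t = segment Delta x t.
  move=> t0; rewrite /segment /restrC; congr insubd.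
  apply/funext => s /=; rewrite freezeE//.
  by have /andP[+ _] := clamp_bounds Delta_ge0 s; lra.
split; first split => // s s0.
  have [sD|Ds] := leP s (- Delta).
    rewrite /freeze (max_idPl sD) C_before// xphi//.
    by rewrite in_itv/= lexx oppr_le0.
  by rewrite freezeE ?(ltW Ds)// xphi// in_itv/= (ltW Ds).
move=> t t0; rewrite sE ?(ltW t0)//.
apply: near_eq_is_derive (dx t t0).
have : t \in `]0, +oo[ by rewrite in_itv/= t0.
move=> /near_in_itvoy; apply: filterS => u; rewrite in_itv/= andbT => u0.
by rewrite -sE ?(ltW u0)// Dop_segment.
Qed.

Lemma trajectory_solution f phi x : lipschitz_on_balls f ->
  trajectory d A f phi x -> solution d A f phi x.
Proof.
move=> fL xt; have [[xc xphi] dx] := xt.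
have Dx : (fun t => Dop d A (segment Delta x t)) = N x.
  by apply/funext => t; rewrite Dop_segment.
split.
- exact: continuous_subspaceT.
- by move=> s; rewrite in_itv/= => /andP[_ s0]; exact: xphi.
- by rewrite Dx.
- under eq_fun do rewrite !Dop_segment//.
  apply/cvgrPdist_le => e e0.
  near=> h.
  have h0 : 0 < h by near: h; exact: nbhs_right_gt.
  have : forall th, 0 <= th <= h ->
      `|N x th - N x 0 - th *: f phi| <= e * th.
    by near: h; exact: neutral_expansion.
  move=> /(_ h); rewrite lexx (ltW h0) => /(_ isT) E.
  rewrite (segment0 Delta_ge0 xc xphi) distrC.
  have -> : h^-1 *: (N x h - N x 0) - f phi =
      h^-1 *: (N x h - N x 0 - h *: f phi).
    by rewrite [RHS]scalerBr scalerA mulVf ?scale1r// gt_eqF.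
  by rewrite normrZ gtr0_norm ?invr_gt0// mulrC ler_pdivrMr.
- apply: continuous_subspaceT; exact: continuous_along.
Unshelve. all: by end_near. Qed.

(** * A Lyapunov functional forces exponential stability *)

Lemma Dplus_ext f g V phi : f phi = g phi ->
  Dplus d A f V phi = Dplus d A g V phi.
Proof. by move=> fg; rewrite /Dplus /phi_shift fg. Qed.

(** The right-hand side [g] of the trajectory need only agree with [f] as long as
the estimate is claimed: it will be a truncation of [f]. *)
Lemma lyapunov_estimate f V (a1 a2 a3 : R) : zero_UAS A d ->
  0 < a1 -> 0 < a2 -> 0 < a3 -> locally_lipschitz V ->
  (forall phi, (a1 * enorm (Dop d A phi) <= V phi <= a2 * cnorm phi) /\
     (Dplus d A f V phi <= (- a3 * V phi)%:E)%E) ->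
  exists B lam : R, [/\ 0 < B, 0 < lam & forall g phi x b,
    lipschitz_on_balls g -> trajectory d A g phi x ->
    (forall t, 0 <= t <= b -> g (segment Delta x t) = f (segment Delta x t)) ->
    forall t, 0 <= t <= b -> `|x t| <= B * cnorm phi * expR (- lam * t)].
Proof.
move=> UAS a10 a20 a30 VL HV.
have [M [lam [M0 lam0 HM]]] := difference_exponential Delta_gt0 d_bounds UAS a30.
have r0 : 0 < a2 / a1 by rewrite divr_gt0.
exists (M * (1 + a2 / a1)), lam; split => //; first by rewrite mulr_gt0// addr_gt0.
move=> g phi x b gL xt gf t tb; have [[xc xphi] _] := xt.
have c0 : 0 <= cnorm phi by exact: cnorm_ge0.
have V0 psi : 0 <= V psi.
  have [/andP[h _] _] := HV psi; rewrite (le_trans _ h)// mulr_ge0 ?sqrtr_ge0//.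
  exact: ltW.
have decay := lyapunov_decay Delta_gt0 d_bounds a30 gL VL (V0 phi) xt.
have -> : M * (1 + a2 / a1) * cnorm phi = M * (cnorm phi + a2 / a1 * cnorm phi).
  by ring.
apply: (HM x b) tb => // [s s0|{}t tb].
  by rewrite xphi// norm_le_cnorm.
have Vt : V (segment Delta x t) <= V phi * expR (- a3 * t).
  apply: (decay b) tb => // s /andP[s0 sb].
  rewrite (@Dplus_ext _ f); last by rewrite gf// s0 ltW.
  by have [] := HV (segment Delta x s).
have [/andP[h1 _] _] := HV (segment Delta x t).
have [/andP[_ h2] _] := HV phi.
rewrite -(Dop_segment A Delta_gt0 d_bounds)//.
apply: (le_trans (norm_le_enorm _)).
rewrite -(ler_pM2l a10) (le_trans h1)// (le_trans Vt)//.
have -> : a1 * (a2 / a1 * cnorm phi * expR (- a3 * t)) =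
    a2 * cnorm phi * expR (- a3 * t) by field; rewrite gt_eqF.
by rewrite ler_wpM2r ?expR_ge0.
Qed.

(** Truncating [f] at a level above the a priori bound gives a global trajectory
that never leaves the region where the truncation is invisible. *)
Lemma lyapunov_sufficient f V (a1 a2 a3 : R) : zero_UAS A d ->
  lipschitz_on_balls f ->
  0 < a1 -> 0 < a2 -> 0 < a3 -> locally_lipschitz V ->
  (forall phi, (a1 * enorm (Dop d A phi) <= V phi <= a2 * cnorm phi) /\
     (Dplus d A f V phi <= (- a3 * V phi)%:E)%E) ->
  zero_GES d A f.
Proof.
move=> UAS fL a10 a20 a30 VL HV.
have [B [lam [B0 lam0 HB]]] := lyapunov_estimate UAS a10 a20 a30 VL HV.
have n0 : 0 < n%:R + 1 :> R by rewrite ltr_wpDl.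
exists ((n%:R + 1) * B), lam; split => //; first by rewrite mulr_gt0.
move=> phi; split; last first.
  move=> x xs t t0; have xt := solution_trajectory xs.
  have := HB f phi _ t fL xt (fun _ _ => erefl) t; rewrite t0 lexx => /(_ isT).
  rewrite freezeE; last by rewrite (le_trans _ t0)// oppr_le0.
  move=> xB; apply: (le_trans (enorm_le_norm _)).
  have -> : (n%:R + 1) * B * expR (- lam * t) * cnorm phi =
    (n%:R + 1) * (B * cnorm phi * expR (- lam * t)) by ring.
  by rewrite ler_pM// lerDl.
have c0 : 0 <= cnorm phi by exact: cnorm_ge0.
pose H := B * cnorm phi + cnorm phi + 1.
have BH : B * cnorm phi < H by rewrite /H; lra.
have cH : cnorm phi <= H by rewrite /H; have := mulr_ge0 (ltW B0) c0; lra.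
have H0 : 0 <= H by exact: le_trans cH.
have [L L0 gL] := trunc_lipschitz Delta_ge0 H0 fL.
pose g := f \o trunc H (n := n) (Delta := Delta).
have [x xt] := trajectory_exists A Delta_gt0 d_bounds phi L0 gL.
have [[xc xphi] dx] := xt.
have gB := lipschitz_with_on_balls L0 gL.
have gf b : (forall s, 0 <= s <= b -> `|x s| <= H) ->
    forall t, 0 <= t <= b -> g (segment Delta x t) = f (segment Delta x t).
  move=> xH t /andP[t0 tb]; rewrite /g /= trunc_id// => s.
  rewrite (segmentE Delta_ge0 _ _ xc).
  have /andP[_ s0] := clamp_bounds Delta_ge0 s.
  have [u0|u0] := leP (t + clamp Delta s) 0.
    by rewrite xphi// (le_trans (norm_le_cnorm Delta_ge0 _ _)).
  by apply: xH; rewrite (ltW u0)/=; lra.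
have xH t : 0 <= t -> `|x t| <= H.
  move=> t0; rewrite -subr_le0.
  apply: (@continuation R (fun t => `|x t| - H) t); last by rewrite t0 lexx.
  - move=> s; apply: (@continuousB R R R (fun t => `|x t|) (cst H));
      last exact: cst_continuous.
    by apply: continuous_comp; [exact: xc|exact: norm_continuous].
  - by rewrite xphi// subr_le0 (le_trans (norm_le_cnorm Delta_ge0 _ _)).
  move=> s /andP[s0 st] xs.
  have xsH u : 0 <= u <= s -> `|x u| <= H by move=> us; rewrite -subr_le0 xs.
  have := HB g phi x s gB xt (gf s xsH) s; rewrite s0 lexx => /(_ isT) xB.
  have xsH' : `|x s| < H.
    rewrite (le_lt_trans xB)// (le_lt_trans _ BH)// ler_piMr//.
      by rewrite mulr_ge0// ltW.
    by rewrite -expR0 ler_expR mulNr oppr_le0 mulr_ge0// ltW.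
  have /cvgrPdist_lt/(_ (H - `|x s|)) := xc s; rewrite subr_gt0 => /(_ xsH').
  move=> /nbhs_ballP[r /= r0 Hr]; near=> h.
  have h0 : 0 < h by near: h; exact: nbhs_right_gt.
  have hr : h < r by near: h; exact: nbhs_right_lt.
  have : ball s r (s + h).
    by rewrite /ball/= opprD addNKr normrN gtr0_norm.
  move=> /Hr; have := ler_distD 0 (x s) (x (s + h)).
  have := lerB_dist (x (s + h)) (x s); rewrite distrC; lra.
exists x; apply: trajectory_solution => //; split => // t t0.
by rewrite -(gf t) ?(ltW t0) ?lexx//; [exact: dx|move=> s /andP[s0 _]; exact: xH].
Unshelve. all: by end_near. Qed.

End Equivalence.

(** * Exponential stability provides a Lyapunov functional *)

Section Converse.
Context (R : realType) (n p : nat) (Delta : R) (d : 'I_p -> R).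
Context (A : 'I_p -> 'M[R]_n) (f : C Delta n -> 'cV[R]_n).
Context (Delta_gt0 : 0 < Delta) (d_bounds : forall j, 0 < d j <= Delta).
Context (f_lip : lipschitz_on_balls f).
Implicit Types (phi psi : C Delta n) (x y z : R -> 'cV[R]_n).

Let Delta_ge0 : 0 <= Delta := ltW Delta_gt0.

Let d_gt0 j : 0 < d j. Proof. by case/andP: (d_bounds j). Qed.

Let d_ge0 j : 0 <= d j. Proof. exact: ltW. Qed.

Local Notation a := (delay_gain A).

(* [X phi] is the trajectory that starts at [phi]; [M] bounds the overshoot of
all trajectories, and [2 * mu] is their decay rate. *)
Context (M mu : R) (M_ge1 : 1 <= M) (mu_gt0 : 0 < mu).
Context (X : C Delta n -> R -> 'cV[R]_n).
Context (X_trajectory : forall phi, trajectory d A f phi (X phi)).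
Context (decay : forall phi x, trajectory d A f phi x ->
  forall t, 0 <= t -> `|x t| <= M * expR (- (2 * mu) * t) * cnorm phi).

Let M_ge0 : 0 <= M := le_trans ler01 M_ge1.

Let X_past phi s : s <= 0 -> X phi s = phi s.
Proof. by have [[_ +] _] := X_trajectory phi; exact. Qed.

Lemma trajectory_bounded phi x t : trajectory d A f phi x ->
  `|x t| <= M * cnorm phi.
Proof.
move=> xt; have [[xc xphi] _] := xt.
have c0 : 0 <= cnorm phi by exact: cnorm_ge0.
have [t0|/ltW t0] := leP 0 t; last first.
  by rewrite xphi// (le_trans (norm_le_cnorm Delta_ge0 _ _))// ler_peMl.
rewrite (le_trans (decay xt t0))// ler_wpM2r// ler_piMr//.
by rewrite -expR0 ler_expR mulNr oppr_le0 !mulr_ge0// ltW.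
Qed.

Lemma trajectory_lipschitz K : 0 <= K -> exists2 gam : R, 0 < gam &
  forall phi psi x y c, trajectory d A f phi x -> trajectory d A f psi y ->
  cnorm phi <= K -> cnorm psi <= K -> (forall s, `|phi s - psi s| <= c) ->
  forall t, 0 <= t -> `|x t - y t| <= (3 + 4 * a) * c * expR (gam * t).
Proof.
move=> K0; have [L L0 HL] := f_lip (M * K).
have [gam st] := steep_exists A (ltW L0) d_gt0.
exists gam; first by case: st.
move=> phi psi x y c xt yt pK sK ps t t0.
have c0 : 0 <= c by rewrite (le_trans _ (ps 0)).
apply: (trajectory_dist_le Delta_gt0 d_bounds (b := t) st (ltW L0) c0 xt yt) => //.
  have bd th z : cnorm th <= K -> trajectory d A f th z -> forall u s,
      `|segment Delta z u s| <= M * K.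
    move=> tK zt u s; have [[zc _] _] := zt.
    rewrite (segmentE Delta_ge0 _ _ zc) (le_trans (trajectory_bounded _ zt))//.
    by rewrite ler_wpM2l.
  move=> u m _ um; apply: HL => // s; [exact: (bd phi)|exact: (bd psi)].
by rewrite t0 lexx.
Qed.

Lemma trajectory_unique phi x t : trajectory d A f phi x -> 0 <= t ->
  x t = X phi t.
Proof.
move=> xt t0; have c0 : 0 <= cnorm phi by exact: cnorm_ge0.
have [gam _ H] := trajectory_lipschitz c0.
apply/eqP; rewrite -subr_eq0 -normr_le0.
have := H phi phi x (X phi) 0 xt (X_trajectory phi) (lexx _) (lexx _) _ t t0.
rewrite mulr0 mul0r; apply => s.
by rewrite subrr normr0.
Qed.

(** Half of the decay rate is spent on the weight. The supremum includes the
initial segment, so that the functional controls the norm of its argument. *)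
Definition weighted_values phi : set R :=
  [set expR (mu * t) * `|X phi t| | t in [set t | - Delta <= t]].

Definition lyapunov phi : R := sup (weighted_values phi).

Local Notation V := lyapunov.

Lemma weighted_value_le phi t : - Delta <= t ->
  expR (mu * t) * `|X phi t| <= M * expR (- mu * t) * cnorm phi.
Proof.
move=> tD; have c0 : 0 <= cnorm phi by exact: cnorm_ge0.
have [t0|/ltW t0] := leP 0 t.
  rewrite (le_trans (ler_wpM2l (expR_ge0 _) (decay (X_trajectory phi) t0)))//.
  rewrite mulrA mulrCA -expRD ler_wpM2r// ler_wpM2l// ler_expR; lra.
rewrite X_past// ler_pM ?expR_ge0 ?norm_le_cnorm//.
rewrite (@le_trans _ _ (expR (- mu * t)))// ?ler_peMl ?expR_ge0//.
have := mulr_ge0 (ltW mu_gt0) (_ : 0 <= - t); rewrite oppr_ge0 => /(_ t0).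
by rewrite ler_expR; lra.
Qed.

Lemma weighted_values_bounded phi :
  ubound (weighted_values phi) (M * expR (mu * Delta) * cnorm phi).
Proof.
move=> _ [t /= tD <-]; rewrite (le_trans (weighted_value_le phi tD))//.
rewrite ler_wpM2r ?cnorm_ge0// ler_wpM2l// ler_expR mulNr -mulrN ler_pM2l//.
by rewrite lerNl.
Qed.

Lemma le_lyapunov phi t : - Delta <= t -> expR (mu * t) * `|X phi t| <= V phi.
Proof.
move=> tD; apply: ub_le_sup; last by exists t.
by exists (M * expR (mu * Delta) * cnorm phi); exact: weighted_values_bounded.
Qed.

Lemma lyapunov_le phi c :
  (forall t, - Delta <= t -> expR (mu * t) * `|X phi t| <= c) -> V phi <= c.
Proof.
move=> H; apply: ge_sup; last by move=> _ [t tD <-]; exact: H.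
by exists (expR (mu * 0) * `|X phi 0|), 0 => //=; rewrite oppr_le0.
Qed.

Lemma lyapunov_le_cnorm phi : V phi <= M * expR (mu * Delta) * cnorm phi.
Proof. by apply: lyapunov_le => t tD; apply: weighted_values_bounded; exists t. Qed.

Lemma lyapunov_ge0 phi : 0 <= V phi.
Proof.
apply: le_trans (le_lyapunov phi (_ : - Delta <= 0)); last by rewrite oppr_le0.
by rewrite mulr_ge0// expR_ge0.
Qed.

Lemma norm_le_lyapunov phi s : `|phi s| <= expR (mu * Delta) * V phi.
Proof.
rewrite (C_clamp phi); have := clamp_bounds Delta_ge0 s.
move: (clamp Delta s) => {}s /andP[sD s0].
have := le_lyapunov phi sD; rewrite X_past// => h.
apply: (@le_trans _ _ (expR (mu * Delta) * (expR (mu * s) * `|phi s|))).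
  rewrite -[leLHS]mul1r.
  rewrite mulrA ler_wpM2r// -expRD -expR0 ler_expR -mulrDr mulr_ge0 ?(ltW mu_gt0)//.
  by rewrite -lerBlDl sub0r.
by rewrite ler_wpM2l// expR_ge0.
Qed.

(** After a time that does not depend on the trajectory the weighted values have
fallen below the initial norm. The supremum is thus taken over a bounded time
interval, on which trajectories depend Lipschitz continuously on their
initial state. *)
Lemma lyapunov_lipschitz K : 0 <= K -> exists2 L : R, 0 < L &
  forall phi psi c, cnorm phi <= K -> cnorm psi <= K ->
    (forall s, `|phi s - psi s| <= c) -> V phi <= V psi + L * c.
Proof.
move=> K0; have [gam gam0 Hgam] := trajectory_lipschitz K0.
have a0 := @delay_gain_ge0 R n p A.
pose Q := M * n%:R * expR (mu * Delta).
have Q0 : 0 <= Q by rewrite /Q !mulr_ge0// expR_ge0.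
pose T := Q / mu.
have T0 : 0 <= T by rewrite divr_ge0// ltW.
have QT : Q * expR (- mu * T) <= 1.
  rewrite mulNr expRN -ler_pdivlMr ?invr_gt0 ?expR_gt0// div1r invrK.
  by rewrite /T mulrCA mulfV ?gt_eqF// mulr1 (le_trans _ (expR_ge1Dx _))// lerDr.
pose L := expR (mu * T) * ((3 + 4 * a) * expR (gam * T)) + 1.
have L1 : 0 <= expR (mu * T) * ((3 + 4 * a) * expR (gam * T)).
  by rewrite !mulr_ge0 ?expR_ge0 ?addr_ge0// mulr_ge0.
exists L => [|phi psi c pK sK ps]; first by rewrite ltr_wpDl.
have c0 : 0 <= c by rewrite (le_trans _ (ps 0)).
have V0 := lyapunov_ge0 psi.
have eD : 1 <= expR (mu * Delta).
  by rewrite -expR0 ler_expR mulr_ge0// ltW.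
apply: lyapunov_le => t tD; have [tT|Tt] := leP t T; last first.
  have phiV s : `|phi s| <= expR (mu * Delta) * (V psi + c).
    rewrite -[phi s](subrK (psi s)) (le_trans (ler_normD _ _))// addrC mulrDr.
    by rewrite lerD ?norm_le_lyapunov// (le_trans (ps s))// ler_peMl.
  rewrite (le_trans (weighted_value_le phi tD))//.
  have := cnorm_leN Delta_ge0 phiV => cn.
  have eT : expR (- mu * t) <= expR (- mu * T).
    by rewrite ler_expR !mulNr lerN2 ler_pM2l// ltW.
  have E0 : 0 <= M * expR (- mu * t) by rewrite mulr_ge0// expR_ge0.
  rewrite (le_trans (ler_wpM2l E0 cn))//.
  have -> : M * expR (- mu * t) * (n%:R * (expR (mu * Delta) * (V psi + c))) =
    Q * expR (- mu * t) * (V psi + c) by rewrite /Q; ring.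
  have Vc : 0 <= V psi + c by rewrite addr_ge0.
  rewrite (@le_trans _ _ (V psi + c))//.
    by rewrite ler_piMl// (le_trans _ QT)// ler_wpM2l.
  by rewrite lerD2l ler_peMl// /L lerDr.
have dist : `|X phi t - X psi t| <= (3 + 4 * a) * c * expR (gam * T).
  have [t0|/ltW t0] := leP 0 t.
    have := Hgam phi psi _ _ c (X_trajectory _) (X_trajectory _) pK sK ps t t0.
    move=> /le_trans; apply.
    rewrite ler_wpM2l ?ler_expR ?ler_pM2l// mulr_ge0// addr_ge0// mulr_ge0//.
  rewrite !X_past// (le_trans (ps t))//.
  have e1 : 1 <= expR (gam * T) by rewrite -expR0 ler_expR mulr_ge0// ltW.
  rewrite (@le_trans _ _ ((3 + 4 * a) * c))//.
    by rewrite ler_peMl//; lra.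
  by rewrite ler_peMr// mulr_ge0// addr_ge0// mulr_ge0.
rewrite -[X phi t](subrK (X psi t)).
rewrite (le_trans (ler_wpM2l (expR_ge0 _) (ler_normD _ _)))// mulrDr addrC.
rewrite lerD ?le_lyapunov//.
have eT : expR (mu * t) <= expR (mu * T) by rewrite ler_expR ler_pM2l.
rewrite (le_trans (ler_pM (expR_ge0 _) (normr_ge0 _) eT dist))//.
have -> : L * c = expR (mu * T) * ((3 + 4 * a) * c * expR (gam * T)) + c.
  by rewrite /L; ring.
by rewrite lerDl.
Qed.

Lemma lyapunov_locally_lipschitz : locally_lipschitz V.
Proof.
move=> phi; pose K := n%:R * (cnorm phi + 1).
have c0 : 0 <= cnorm phi by exact: cnorm_ge0.
have K0 : 0 <= K by rewrite mulr_ge0// addr_ge0.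
have [L L0 HL] := lyapunov_lipschitz K0.
exists 1, L; split => // phi1 phi2 h1 h2.
have hK psi : cnorm (psi - phi) <= 1 -> cnorm psi <= K.
  move=> h; apply: (cnorm_leN Delta_ge0) => s.
  have e : `|psi s - phi s| <= 1.
    exact: le_trans (norm_le_cnorm Delta_ge0 (psi - phi) s) h.
  rewrite -[psi s](subrK (phi s)) (le_trans (ler_normD _ _))// addrC lerD//.
  exact: norm_le_cnorm.
have e12 s : `|phi1 s - phi2 s| <= cnorm (phi1 - phi2).
  exact: (norm_le_cnorm Delta_ge0 (phi1 - phi2) s).
have e21 s : `|phi2 s - phi1 s| <= cnorm (phi1 - phi2) by rewrite distrC.
have l1 := HL _ _ _ (hK _ h1) (hK _ h2) e12.
have l2 := HL _ _ _ (hK _ h2) (hK _ h1) e21.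
by rewrite ler_distl lerBlDr; apply/andP; split.
Qed.

(** By uniqueness the trajectory that starts at the later state is the shifted
trajectory, whose weighted values carry the factor [expR (- mu * h)]. *)
Lemma lyapunov_segment_le phi h : 0 <= h ->
  V (segment Delta (X phi) h) <= expR (- mu * h) * V phi.
Proof.
move=> h0; have [[xc _] _] := X_trajectory phi.
have yt := trajectory_shift Delta_gt0 d_bounds h0 (X_trajectory phi).
apply: lyapunov_le => t tD.
have -> : X (segment Delta (X phi) h) t = X phi (t + h).
  have [t0|/ltW t0] := leP 0 t.
    by rewrite -(trajectory_unique yt t0) freezeE.
  by rewrite X_past// (segmentE Delta_ge0 _ _ xc) clamp_in ?tD// addrC.
have tD' : - Delta <= t + h by rewrite (le_trans tD)// lerDl.
rewrite -ler_pdivrMl ?expR_gt0// -expRN mulNr opprK mulrA -expRD -mulrDr addrC.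
exact: le_lyapunov.
Qed.

Lemma lyapunov_Dplus phi : (Dplus d A f V phi <= (- (mu / 2) * V phi)%:E)%E.
Proof.
apply/(Dplus_trajectoryP Delta_gt0 d_bounds _ f_lip lyapunov_locally_lipschitz
  (X_trajectory phi)) => e e0.
near=> h.
have h0 : 0 < h by near: h; exact: nbhs_right_gt.
have hm : h <= mu^-1 by near: h; apply: nbhs_right_le; rewrite invr_gt0.
have y0 : 0 <= mu * h by rewrite mulr_ge0// ltW.
have y1 : mu * h <= 1 by rewrite mulrC -ler_pdivlMr// div1r.
have V0 := lyapunov_ge0 phi.
(* [expR (- y) <= 1 / (1 + y) <= 1 - y / 2] for [0 <= y <= 1]. *)
have ey : expR (- mu * h) <= 1 - mu * h / 2.
  rewrite mulNr expRN (@le_trans _ _ ((1 + mu * h)^-1))//.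
    by rewrite lef_pV2 ?posrE ?expR_gt0 ?expR_ge1Dx// ltr_wpDr.
  rewrite -div1r ler_pdivrMr ?ltr_wpDr//.
  set y := mu * h in y0 y1 *; have := mulr_ge0 y0 (_ : 0 <= 1 - y).
  rewrite subr_ge0 => /(_ y1); lra.
have := lyapunov_segment_le phi (ltW h0).
have := ler_wpM2r V0 ey.
have := mulr_ge0 (ltW h0) (ltW e0).
lra.
Unshelve. all: by end_near. Qed.

Lemma Dop_le_lyapunov phi :
  enorm (Dop d A phi) <= n%:R * ((1 + a) * expR (mu * Delta)) * V phi.
Proof.
apply: (le_trans (enorm_le_norm _)).
rewrite -mulrA ler_wpM2l// -mulrA.
rewrite -(neutral0 A Delta_gt0 d_bounds (X_trajectory phi).1).
apply: norm_neutral_le => // s s0; rewrite X_past//.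
exact: norm_le_lyapunov.
Qed.

End Converse.

(** * The Lyapunov characterization *)

Theorem theorem2 (R : realType) (n p : nat) (Delta : R) (d : 'I_p -> R)
    (A : 'I_p -> 'M[R]_n) (f : C Delta n -> 'cV[R]_n)
    (n_gt0 : (0 < n)%N) (p_gt0 : (0 < p)%N) (Delta_gt0 : 0 < Delta)
    (d_bounds : forall j, 0 < d j <= Delta)
    (f_lip : lipschitz_on_bounded f) (f0 : f 0 = 0)
    (D_stable : strongly_stable A) :
  zero_GES d A f <->
  exists V : C Delta n -> R,
    (forall phi, 0 <= V phi) /\
    locally_lipschitz V /\
    exists a1 a2 a3 : R, [/\ 0 < a1, 0 < a2, 0 < a3 &
      forall phi : C Delta n,
        (a1 * enorm (Dop d A phi) <= V phi <= a2 * cnorm phi) /\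
        (Dplus d A f V phi <= (- a3 * V phi)%:E)%E].
Proof.
have fL := lipschitz_on_bounded_balls (ltW Delta_gt0) f_lip.
split=> [[M [lam [M0 lam0 H]]]|[V [_ [VL [a1 [a2 [a3 [a10 a20 a30 HV]]]]]]]].
  have tr phi : exists x, trajectory d A f phi x.
    have [[x xs] _] := H phi; exists (freeze Delta x).
    exact: solution_trajectory.
  have [X Xt] := choice tr.
  pose mu := lam / 2; pose M1 := M + 1.
  have mu0 : 0 < mu by rewrite divr_gt0.
  have M1_ge1 : 1 <= M1 by rewrite /M1 lerDr ltW.
  have decay phi x : trajectory d A f phi x ->
      forall t, 0 <= t -> `|x t| <= M1 * expR (- (2 * mu) * t) * cnorm phi.
    move=> xt t t0; have [_ Hx] := H phi.
    have xs := trajectory_solution Delta_gt0 d_bounds fL xt.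
    rewrite (le_trans (norm_le_enorm _))// (le_trans (Hx x xs t t0))//.
    have -> : 2 * mu = lam by rewrite /mu; field.
    by rewrite ler_wpM2r ?cnorm_ge0 ?(ltW Delta_gt0)// ler_wpM2r ?expR_ge0// lerDl.
  have a0 := @delay_gain_ge0 R n p A.
  pose Q := n%:R * ((1 + delay_gain A) * expR (mu * Delta)).
  have Q0 : 0 < Q.
    by rewrite !mulr_gt0 ?expR_gt0 ?ltr0n// ltr_wpDr.
  exists (lyapunov mu X); split; last split.
  - exact: (lyapunov_ge0 Delta_gt0 M1_ge1 mu0 Xt decay).
  - exact: (lyapunov_locally_lipschitz Delta_gt0 d_bounds fL M1_ge1 mu0 Xt decay).
  exists Q^-1, (M1 * expR (mu * Delta)), (mu / 2); split.
  - by rewrite invr_gt0.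
  - by rewrite mulr_gt0 ?expR_gt0// (lt_le_trans ltr01).
  - by rewrite divr_gt0.
  move=> phi; split; last first.
    exact: (lyapunov_Dplus Delta_gt0 d_bounds fL M1_ge1 mu0 Xt decay).
  apply/andP; split.
    rewrite ler_pdivrMl//.
    exact: (Dop_le_lyapunov Delta_gt0 d_bounds M1_ge1 mu0 Xt decay).
  exact: (lyapunov_le_cnorm Delta_gt0 M1_ge1 mu0 Xt decay).
have UAS : zero_UAS A d by apply: D_stable => j; case/andP: (d_bounds j).
exact: (lyapunov_sufficient Delta_gt0 d_bounds UAS fL a10 a20 a30 VL HV).
Qed.
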